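(* There are an absolute constant $c_0$ and a polynomial $q$ such that the following holds. Let $\mathcal F=\{F_i(\bar x)=0\}_{i\in I}$ be a system of polynomial equations over $\mathbb{Q}$ written as constant-free circuits over $\mathbb{Q}$, and let $C(\bar x,\bar y)$ be a constant-free boolean CPS refutation over $\mathbb{Q}$ of $\mathcal F$, such that the circuit $C(\bar x,\mathcal F)$ (obtained by substituting the axiom circuits for the placeholder variables) has size $s$ and syntactic length $t$. Let $r\ge1$ and suppose that for every positive integer $M$ with $\tau(M)\le c_0 s$ the generalized binary value principle $\mathrm{BVP}_{t,M}$ has a constant-free boolean IPS refutation over $\mathbb{Q}$ of size at most $r$. Then $\mathcal F$ has a constant-free boolean IPS refutation over $\mathbb{Q}$ of size at most $q(s,t,r)$.
   Context: Circuits: DAGs with leaves labelled by variables or constants, fan-in-two $+,\times$ gates; size = number of nodes. Constant-free: constants only $0,1,-1$; a constant-free circuit over $\mathbb{Q}$ may also have division gates $u\div v$ where $v$'s subcircuit is variable-free and computes a nonzero constant. $\tau(M)$: minimal size of a constant-free division-free circuit computing the integer $M$. Boolean IPS over $\mathbb{Q}$: a proof of $p$ from $\{f_j=0\}_{j=1}^m$ is a circuit $C(\bar x,y_1,\dots,y_m,z_1,\dots,z_n)$ with $C(\bar x,\bar0,\bar0)=0$ and $C(\bar x,f_1,\dots,f_m,x_1^2-x_1,\dots,x_n^2-x_n)=p$ formally; a refutation proves $1$. Boolean CPS: for equations $\mathcal F$, the inequality list $h_1,\dots,h_\ell$ consists of $f\ge0$ and $-f\ge0$ for each $f=0$ in $\mathcal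 F$ and each $x_i^2-x_i=0$, plus $x_i\ge0$, $1-x_i\ge0$; a squaring gate is a product gate with both inputs from one node; $C(\bar x,\bar y)$ is $\bar y$-conic if every leaf that is a negative constant or an $x$-variable has all paths to the output through a squaring gate; a CPS refutation is a $\bar y$-conic circuit with $C(\bar x,h_1,\dots,h_\ell)=-1$ formally. $\mathrm{BVP}_{t,M}$: the equation $\sum_{i=1}^t2^{i-1}x_i+M=0$. Syntactic length of a division-free circuit over $\mathbb{Z}$: $\ell(x_j)=2$; integer leaf $\alpha$: least $k\ge1$ with $-2^{k-1}\le\alpha<2^{k-1}$; $\ell(G+H)=\max(\ell G,\ell H)+1$; $\ell(G\cdot H)=2\max(\ell G,\ell H)+3$. Syntactic length of a constant-free circuit $D$ over $\mathbb{Q}$: that of the division-free constant-free circuit $D'$ over $\mathbb{Z}$ computing $M_D\cdot\widehat D$ ($M_D$ a nonzero integer) obtained gate by gate, in topological order, by replacing each gate $g$ with circuits computing $M_g\,g$ and the integer $M_g$: for leaves $M_g=1$; for $g=g_j\div g_l$ (with $g_l$ division-free, variable-free) reuse $M_jg_j$ and set $M_g=M_j\cdot g_l$; for $g=g_jg_l$ compute $(M_jg_j)(M_lg_l)$, $M_g=M_jM_l$; for $g=g_j+g_l$ compute $M_l(M_jg_j)+M_j(M_lg_l)$, $M_g=M_jM_l$. *)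

(* Defs.v *)
From HB Require Import structures.
From mathcomp Require Import all_boot all_order all_algebra.
From mathcomp Require Export mpoly.

Set Implicit Arguments.
Unset Strict Implicit.
Unset Printing Implicit Defensive.

Import Order.TTheory GRing.Theory Num.Theory.
Local Open Scope ring_scope.

(* A circuit is a DAG whose nodes are listed in a topological order: the inputs
   of a gate are positions of earlier nodes.  [Div i j] is [i ÷ j]. *)
Inductive gate (V : Type) : Type :=
| Var of V
| Const of int
| Add of nat & nat
| Mul of nat & nat
| Div of nat & nat.

Arguments Const {V}.
Arguments Add {V}.
Arguments Mul {V}.
Arguments Div {V}.

Record circuit (V : Type) : Type :=
  Circuit { nodes : seq (gate V); output : nat }.

Definition csize V (C : circuit V) : nat := size (nodes C).

Definition gate_at V (C : circuit V) (k : nat) : gate V :=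
  nth (Const 0) (nodes C) k.

Definition inputs V (g : gate V) : seq nat :=
  match g with
  | Var _ | Const _ => [::]
  | Add i j | Mul i j | Div i j => [:: i; j]
  end.

Definition well_formed V (C : circuit V) : bool :=
  (output C < csize C)%N &&
  all (fun k => all (fun i => i < k)%N (inputs (gate_at C k)))
      (iota 0 (csize C)).

(* The tree obtained by unfolding the DAG below a node.  The polynomial computed
   by a node, the set of labels occurring below it and its syntactic length do
   not depend on how nodes are shared, and are defined on the unfolding. *)
Inductive expr (V : Type) : Type :=
| EVar of V
| EConst of int
| EAdd of expr V & expr V
| EMul of expr V & expr V
| EDiv of expr V & expr V.

Arguments EConst {V}.

Definition unfold_gate V (T : seq (expr V)) (g : gate V) : expr V :=
  let e := nth (EConst 0) T in
  match g with
  | Var v => EVar v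
  | Const c => EConst c
  | Add i j => EAdd (e i) (e j)
  | Mul i j => EMul (e i) (e j)
  | Div i j => EDiv (e i) (e j)
  end.

Definition unfold_at V (C : circuit V) (k : nat) : expr V :=
  nth (EConst 0)
      (foldl (fun T g => rcons T (unfold_gate T g)) [::] (nodes C)) k.

Definition unfold V (C : circuit V) : expr V := unfold_at C (output C).

Fixpoint eeval V (A : unitRingType) (rho : V -> A) (e : expr V) : A :=
  match e with
  | EVar v => rho v
  | EConst c => c%:~R
  | EAdd a b => eeval rho a + eeval rho b
  | EMul a b => eeval rho a * eeval rho b
  | EDiv a b => eeval rho a / eeval rho b
  end.

Definition ceval V (A : unitRingType) (rho : V -> A) (C : circuit V) : A :=
  eeval rho (unfold C).

Definition cpoly n (C : circuit 'I_n) : {mpoly rat[n]} :=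
  ceval (fun i => 'X_i) C.

Fixpoint variable_free V (e : expr V) : bool :=
  match e with
  | EVar _ => false
  | EConst _ => true
  | EAdd a b | EMul a b | EDiv a b => variable_free a && variable_free b
  end.

Fixpoint division_free V (e : expr V) : bool :=
  match e with
  | EVar _ | EConst _ => true
  | EAdd a b | EMul a b => division_free a && division_free b
  | EDiv _ _ => false
  end.

Definition small_const V (g : gate V) : bool :=
  if g is Const c then c \in [:: 0; 1; -1] else true.

(* The valuation [fun _ => 0] is immaterial: the denominator is variable-free. *)
Definition legal_div V (C : circuit V) (g : gate V) : bool :=
  if g is Div _ j then
    variable_free (unfold_at C j) &&
    (eeval (fun _ => 0 : rat) (unfold_at C j) != 0)
  else true.

Definition constant_free V (C : circuit V) : bool :=
  [&& well_formed C, all (@small_const V) (nodes C)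
    & all (legal_div C) (nodes C)].

Definition is_div V (g : gate V) : bool := if g is Div _ _ then true else false.

Definition computes_int (C : circuit void) (M : int) : Prop :=
  [/\ constant_free C, ~~ has (@is_div void) (nodes C)
    & ceval (fun v : void => match v with end : rat) C = M%:~R].

Definition is_tau (M : int) (k : nat) : Prop :=
  (exists2 C, computes_int C M & csize C = k) /\
  (forall C, computes_int C M -> (k <= csize C)%N).

Inductive ips_var (n m : nat) : Type :=
| IpsX of 'I_n
| IpsY of 'I_m
| IpsZ of 'I_n.

Definition ips_at_zero n m (v : ips_var n m) : {mpoly rat[n]} :=
  match v with
  | IpsX i => 'X_i
  | IpsY _ | IpsZ _ => 0
  end.

Definition ips_at_axioms n m (f : 'I_m -> {mpoly rat[n]}) (v : ips_var n m) :
    {mpoly rat[n]} :=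
  match v with
  | IpsX i => 'X_i
  | IpsY j => f j
  | IpsZ i => 'X_i ^+ 2 - 'X_i
  end.

Definition ips_proof n m (f : 'I_m -> {mpoly rat[n]}) (p : {mpoly rat[n]})
    (C : circuit (ips_var n m)) : Prop :=
  ceval (@ips_at_zero n m) C = 0 /\ ceval (ips_at_axioms f) C = p.

Definition ips_refutation n m (f : 'I_m -> {mpoly rat[n]})
    (C : circuit (ips_var n m)) : Prop :=
  ips_proof f 1 C.

Definition bvp (t : nat) (M : int) : 'I_1 -> {mpoly rat[t]} :=
  fun _ => (\sum_(i < t) 2 ^+ i * 'X_i) + M%:~R.

(* The index set of the list h_1, ..., h_l of inequalities. *)
Inductive ineq (n m : nat) : Type :=
| EqGe of 'I_m       (* f_j >= 0 *)
| EqLe of 'I_m       (* - f_j >= 0 *)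
| BoolGe of 'I_n     (* x_i ^ 2 - x_i >= 0 *)
| BoolLe of 'I_n     (* - (x_i ^ 2 - x_i) >= 0 *)
| VarGe0 of 'I_n     (* x_i >= 0 *)
| VarLe1 of 'I_n.    (* 1 - x_i >= 0 *)

Definition ineq_code n m (a : ineq n m) : bool * 'I_m + ('I_3 * 'I_n + 'I_n) :=
  match a with
  | EqGe j => inl (true, j)
  | EqLe j => inl (false, j)
  | BoolGe i => inr (inl (inord 0, i))
  | BoolLe i => inr (inl (inord 1, i))
  | VarGe0 i => inr (inl (inord 2, i))
  | VarLe1 i => inr (inr i)
  end.

Definition ineq_decode n m (c : bool * 'I_m + ('I_3 * 'I_n + 'I_n)) : ineq n m :=
  match c with
  | inl (true, j) => EqGe n j
  | inl (false, j) => EqLe n j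
  | inr (inl (k, i)) =>
      if val k is k'.+1 then if k' is 0 then BoolLe m i else VarGe0 m i
      else BoolGe m i
  | inr (inr i) => VarLe1 m i
  end.

Lemma ineq_codeK n m : cancel (@ineq_code n m) (@ineq_decode n m).
Proof. by case=> i //=; rewrite inordK. Qed.

HB.instance Definition _ n m :=
  Equality.copy (ineq n m) (can_type (@ineq_codeK n m)).

Inductive cps_var (n m : nat) : Type :=
| CpsX of 'I_n
| CpsY of ineq n m.

Definition neg_circuit V (D : circuit V) : circuit V :=
  Circuit (nodes D ++ [:: Const (-1); Mul (csize D) (output D)]) (csize D).+1.

Definition bool_circuit n (i : 'I_n) : circuit 'I_n :=
  Circuit [:: Var i; Mul 0 0; Const (-1); Mul 2 0; Add 1 3] 4.

Definition ineq_circuit n m (F : 'I_m -> circuit 'I_n) (a : ineq n m) :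
    circuit 'I_n :=
  match a with
  | EqGe j => F j
  | EqLe j => neg_circuit (F j)
  | BoolGe i => bool_circuit i
  | BoolLe i => neg_circuit (bool_circuit i)
  | VarGe0 i => Circuit [:: Var i] 0
  | VarLe1 i => Circuit [:: Const 1; Const (-1); Var i; Mul 1 2; Add 0 3] 4
  end.

Definition cps_at_axioms n m (F : 'I_m -> circuit 'I_n) (v : cps_var n m) :
    {mpoly rat[n]} :=
  match v with
  | CpsX i => 'X_i
  | CpsY a => cpoly (ineq_circuit F a)
  end.

Definition wire V (C : circuit V) : rel nat :=
  fun i j => i \in inputs (gate_at C j).

Definition squaring V (C : circuit V) (k : nat) : bool :=
  if gate_at C k is Mul i j then i == j else false.

Definition must_be_squared n m (g : gate (cps_var n m)) : bool :=
  match g with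
  | Const c => c < 0
  | Var (CpsX _) => true
  | _ => false
  end.

Definition conic n m (C : circuit (cps_var n m)) : Prop :=
  forall (k : nat) (p : seq nat),
    must_be_squared (gate_at C k) ->
    path (wire C) k p -> last k p = output C ->
    has (squaring C) (k :: p).

Definition cps_refutation n m (F : 'I_m -> circuit 'I_n)
    (C : circuit (cps_var n m)) : Prop :=
  conic C /\ ceval (cps_at_axioms F) C = -1.

(* The circuit C(x, F).  One copy of the axiom circuit is laid out for every
   placeholder variable occurring in [C]; all leaves labelled by that
   placeholder are redirected to the output of the copy.  All other nodes of
   [C] are kept. *)

Definition shift_gate V (d : nat) (g : gate V) : gate V :=
  match g with
  | Var v => Var v
  | Const c => Const c
  | Add i j => Add (d + i) (d + j)
  | Mul i j => Mul (d + i) (d + j)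
  | Div i j => Div (d + i) (d + j)
  end.

Definition placeholder n m (g : gate (cps_var n m)) : option (ineq n m) :=
  if g is Var (CpsY a) then Some a else None.

Definition placeholders n m (C : circuit (cps_var n m)) : seq (ineq n m) :=
  undup (pmap (@placeholder n m) (nodes C)).

(* The nodes laid out so far, and the positions of the outputs of the copies. *)
Definition lay_axiom n m (F : 'I_m -> circuit 'I_n)
    (st : seq (gate 'I_n) * seq nat) (a : ineq n m) :
    seq (gate 'I_n) * seq nat :=
  let: (code, pos) := st in
  let D := ineq_circuit F a in
  (code ++ [seq shift_gate (size code) g | g <- nodes D],
   rcons pos (size code + output D)%N).

(* In the state, [pos] gives the new positions of the nodes of [C] treated so
   far; [loc] gives the positions of the outputs of the axiom circuits. *)
Definition lay_gate n m (loc : ineq n m -> nat)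
    (st : seq (gate 'I_n) * seq nat) (g : gate (cps_var n m)) :
    seq (gate 'I_n) * seq nat :=
  let: (code, pos) := st in
  let new h := (rcons code h, rcons pos (size code)) in
  match g with
  | Var (CpsY a) => (code, rcons pos (loc a))
  | Var (CpsX i) => new (Var i)
  | Const c => new (Const c)
  | Add i j => new (Add (nth 0 pos i) (nth 0 pos j))
  | Mul i j => new (Mul (nth 0 pos i) (nth 0 pos j))
  | Div i j => new (Div (nth 0 pos i) (nth 0 pos j))
  end%N.

Definition subst_axioms n m (F : 'I_m -> circuit 'I_n)
    (C : circuit (cps_var n m)) : circuit 'I_n :=
  let ps := placeholders C in
  let: (axs, out) := foldl (lay_axiom F) ([::], [::]) ps in
  let loc a := nth 0%N out (index a ps) in
  let: (code, pos) := foldl (lay_gate loc) (axs, [::]) (nodes C) in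
  Circuit code (nth 0%N pos (output C)).

Lemma int_length_ex (a : int) :
  exists k, (0 < k)%N && (- 2 ^+ k.-1 <= a < 2 ^+ k.-1).
Proof.
exists `|a|%N.+1 => /=.
suff : `|a| < 2 ^+ `|a|%N by rewrite ltr_norml => /andP[/ltW -> ->].
by rewrite -abszE -natrX natz ltz_nat ltn_expl.
Qed.

Definition int_length (a : int) : nat := ex_minn (int_length_ex a).

(* Meaningful on division-free expressions only. *)
Fixpoint elength V (e : expr V) : nat :=
  match e with
  | EVar _ => 2
  | EConst c => int_length c
  | EAdd a b => (maxn (elength a) (elength b)).+1
  | EMul a b => 2 * maxn (elength a) (elength b) + 3
  | EDiv _ _ => 0
  end%N.

(* [multiplier e] computes the integer M_e and [scaled e] computes M_e * e, where
   e is the (unfolded) original gate; in the division case the divisor [b] is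
   used as it is, being division-free and variable-free.  The circuit D' of a
   circuit D over the rationals unfolds to [scaled (unfold D)]. *)
Fixpoint multiplier V (e : expr V) : expr V :=
  match e with
  | EVar _ | EConst _ => EConst 1
  | EAdd a b | EMul a b => EMul (multiplier a) (multiplier b)
  | EDiv a b => EMul (multiplier a) b
  end.

Fixpoint scaled V (e : expr V) : expr V :=
  match e with
  | EVar v => EVar v
  | EConst c => EConst c
  | EAdd a b => EAdd (EMul (multiplier b) (scaled a))
                     (EMul (multiplier a) (scaled b))
  | EMul a b => EMul (scaled a) (scaled b)
  | EDiv a _ => scaled a
  end.

Fixpoint division_free_denominators V (e : expr V) : bool :=
  match e with
  | EVar _ | EConst _ => true
  | EAdd a b | EMul a b =>
      division_free_denominators a && division_free_denominators b
  | EDiv a b => division_free_denominators a && division_free b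
  end.

(* Defined only for circuits whose denominators are division-free, since
   otherwise the multipliers are not division-free circuits over the integers. *)
Definition has_syntactic_length V (D : circuit V) (t : nat) : Prop :=
  division_free_denominators (unfold D) /\ elength (scaled (unfold D)) = t.

(* Main.v *)
(* Every node g of the CPS refutation C, read with its equation and boolean
   placeholders set to 0, satisfies M_g g = P - N for an integer M_g > 0 (the
   product of the absolute values of the denominators below g) and polynomials
   P and N written in binary.  The bits are polynomials in x obtained with
   ripple-carry adders; the adder equations are exact polynomial identities, and
   b^2 - b is derived for every bit b from the boolean axioms.  For conic nodes N can be dropped modulo
   the axioms: sums and products are immediate, and at a squaring gate one
   replaces P - N by its absolute value, which is computed from the borrow bit
   of the subtraction.  The syntactic length bounds the number of bits.  As C
   evaluates to -1 on the axioms, the output node yields a derivation of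
   sum_i 2^i b_i + M = 0, and the refutation of BVP_(t,M) is substituted there.
   The integer M is computed by a circuit of size linear in s. *)

Require Import Defs.
From mathcomp Require Import all_boot all_order all_algebra.
From mathcomp Require Import ring zify.
From Stdlib Require Import Classical.

Set Implicit Arguments.
Unset Strict Implicit.
Unset Printing Implicit Defensive.

Import Order.TTheory GRing.Theory Num.Theory.
Local Open Scope ring_scope.

(** Both conditions on an IPS proof are checked at once by evaluating in the product ring [A * A]:
    the first coordinate sets the placeholders of the IPS circuit to 0, the second sets them to the
    axioms. A circuit proves p exactly when its value is (0, p), so a derivation is a computed value
    with first coordinate 0, and derivations combine by ring operations. The obstacle is the input
    of a squaring gate, which need not be conic: N cannot be dropped there, and nothing is derived
    about its value at the axioms. The exact identity M_g g = P - N in the first coordinate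
    suffices, because the difference of M_g g and P - N then has first coordinate 0 and is a
    derivation by itself. Denominators inside the axiom circuits never enter M, since an IPS circuit
    reads the axioms as variables. Denominators of C may be negative; their absolute values keep M
    positive, and at conic nodes conicity itself excludes negative ones. *)

Section Unfolding.
Variable V : Type.
Implicit Types (ns : seq (gate V)) (C : circuit V) (e : expr V).

Definition exprs ns : seq (expr V) :=
  foldl (fun T g => rcons T (unfold_gate T g)) [::] ns.

Definition expr_at ns k := nth (EConst 0) (exprs ns) k.

Definition topological ns :=
  forall k, (k < size ns)%N ->
    all (fun i => i < k)%N (inputs (nth (Const 0) ns k)).

Fixpoint legal e : bool :=
  match e with
  | EVar _ | EConst _ => true
  | EAdd a b | EMul a b => legal a && legal b
  | EDiv a b => [&& legal a, legal b, variable_free b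
                  & eeval (fun _ => 0 : rat) b != 0]
  end.

Lemma exprs_rcons ns g :
  exprs (rcons ns g) = rcons (exprs ns) (unfold_gate (exprs ns) g).
Proof. by rewrite /exprs foldl_rcons. Qed.

Lemma size_exprs ns : size (exprs ns) = size ns.
Proof.
by elim/last_ind: ns => // ns g IH; rewrite exprs_rcons !size_rcons IH.
Qed.

Lemma expr_at_rcons ns g k : (k < size ns)%N ->
  expr_at (rcons ns g) k = expr_at ns k.
Proof. by move=> lt_k; rewrite /expr_at exprs_rcons nth_rcons size_exprs lt_k. Qed.

Lemma expr_at_last ns g :
  expr_at (rcons ns g) (size ns) = unfold_gate (exprs ns) g.
Proof. by rewrite /expr_at exprs_rcons nth_rcons size_exprs ltnn eqxx. Qed.

Lemma topological_rcons ns g :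
  topological (rcons ns g) <->
  topological ns /\ all (fun i => i < size ns)%N (inputs g).
Proof.
split=> [top | [top topg] k].
  split=> [k lt_k|].
    by have := top k; rewrite size_rcons nth_rcons lt_k; apply; apply: ltnW.
  by have := top (size ns); rewrite size_rcons nth_rcons ltnn eqxx; apply.
rewrite size_rcons nth_rcons ltnS leq_eqVlt => /predU1P[-> | lt_k].
  by rewrite ltnn eqxx.
by rewrite lt_k; apply: top.
Qed.

Lemma eq_unfold_gate (T T' : seq (expr V)) g :
  (forall i, i \in inputs g -> nth (EConst 0) T i = nth (EConst 0) T' i) ->
  unfold_gate T g = unfold_gate T' g.
Proof. by case: g => //= i j eqT; rewrite !eqT ?inE ?eqxx ?orbT. Qed.

Lemma expr_atE ns k : topological ns -> (k < size ns)%N ->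
  expr_at ns k = unfold_gate (exprs ns) (nth (Const 0) ns k).
Proof.
elim/last_ind: ns => // ns g IH /topological_rcons[top topg].
rewrite size_rcons ltnS leq_eqVlt => /predU1P[-> | lt_k].
  rewrite expr_at_last nth_rcons ltnn eqxx; apply: eq_unfold_gate => i.
  move=> ii; have lt_i := (allP topg) i ii.
  by rewrite -!/(expr_at _ _) expr_at_rcons.
rewrite expr_at_rcons // IH // nth_rcons lt_k; apply: eq_unfold_gate => i.
move=> ii; have lt_i := (allP (top _ lt_k)) i ii.
by rewrite -!/(expr_at _ _) expr_at_rcons // (ltn_trans lt_i).
Qed.

Lemma topologicalP C : well_formed C ->
  (output C < csize C)%N /\ topological (nodes C).
Proof.
case/andP=> lt_o /allP top; split=> // k lt_k.
by apply: top; rewrite mem_iota.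
Qed.

Lemma well_formedI C :
  (output C < csize C)%N -> topological (nodes C) -> well_formed C.
Proof.
move=> lt_o top; apply/andP; split=> //; apply/allP => k.
by rewrite mem_iota => /andP[_]; apply: top.
Qed.

Lemma legal_at C k : constant_free C -> (k < csize C)%N ->
  legal (expr_at (nodes C) k).
Proof.
case/and3P=> /topologicalP[_ top] _ /(all_nthP (Const 0)) leg.
elim/ltn_ind: k => k IH lt_k; rewrite expr_atE //.
have := leg _ lt_k; have := top _ lt_k.
case: (nth _ _ k) => //= i j /and3P[lt_i lt_j _]; rewrite -!/(expr_at _ _).
- by rewrite !IH // (ltn_trans _ lt_k).
- by rewrite !IH // (ltn_trans _ lt_k).
- by case/andP=> vf nz; rewrite -!/(expr_at _ _) !IH ?(ltn_trans _ lt_k) ?vf.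
Qed.

End Unfolding.

(** * Evaluation and ring morphisms *)

Section Evaluation.

Lemma eeval_variable_free V (R : comUnitRingType) (iota : {rmorphism rat -> R})
    (rho : V -> R) e :
  legal e -> variable_free e -> eeval rho e = iota (eeval (fun _ => 0) e).
Proof.
elim: e => //= [c | a IHa b IHb | a IHa b IHb | a IHa b IHb].
- by rewrite rmorph_int.
- by case/andP=> ? ? /andP[? ?]; rewrite rmorphD IHa ?IHb.
- by case/andP=> ? ? /andP[? ?]; rewrite rmorphM IHa ?IHb.
- case/and4P=> ? ? ? nz /andP[? ?]; rewrite rmorphM rmorphV ?unitfE //.
  by rewrite IHa ?IHb.
Qed.

(** A legal denominator is the image of a nonzero rational, hence a unit, and on units a morphism
    commutes with inversion. For other denominators the total inverse of a unit ring has default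
    values, which a morphism need not respect. *)
Lemma eeval_morph V (R S : comUnitRingType) (iota : {rmorphism rat -> R})
    (phi : {rmorphism R -> S}) (rho : V -> R) e :
  legal e -> eeval (fun v => phi (rho v)) e = phi (eeval rho e).
Proof.
elim: e => //= [c | a IHa b IHb | a IHa b IHb | a IHa b IHb].
- by rewrite rmorph_int.
- by case/andP=> ? ?; rewrite rmorphD IHa ?IHb.
- by case/andP=> ? ?; rewrite rmorphM IHa ?IHb.
- case/and4P=> ? ? ? nz; rewrite rmorphM rmorphV.
    by rewrite IHa ?IHb.
  by rewrite (eeval_variable_free iota) // rmorph_unit // unitfE.
Qed.

End Evaluation.

(** * Straight-line programs *)

(* The list of values of a straight-line program; the flag records that the
   value has been computed without variables, and [dv] allows divisions. *)
Section StraightLine.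
Variables (V : Type) (R : comUnitRingType) (iota : {rmorphism rat -> R}).
Variables (dv : bool) (rho : V -> R).
Implicit Type l : seq (bool * R).

Inductive slp : seq (bool * R) -> Prop :=
| slp_nil : slp [::]
| slp_var l v : slp l -> slp (rcons l (false, rho v))
| slp_const l c : slp l -> c \in [:: 0; 1; -1] -> slp (rcons l (true, c%:~R))
| slp_add l u w : slp l -> u \in l -> w \in l ->
    slp (rcons l (u.1 && w.1, u.2 + w.2))
| slp_mul l u w : slp l -> u \in l -> w \in l ->
    slp (rcons l (u.1 && w.1, u.2 * w.2))
| slp_div l u w : slp l -> u \in l -> w \in l -> dv -> w.1 -> w.2 != 0 ->
    slp (rcons l (u.1 && w.1, u.2 / w.2)).

Definition legal_gate (ns : seq (gate V)) (g : gate V) : bool :=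
  if g is Div _ j then
    variable_free (expr_at ns j) && (eeval (fun _ => 0 : rat) (expr_at ns j) != 0)
  else true.

Definition realizes (ns : seq (gate V)) l :=
  [/\ size ns = size l /\ topological ns, all (@small_const V) ns,
      (forall k, (k < size ns)%N -> legal_gate ns (nth (Const 0) ns k)),
      (has (@is_div V) ns -> dv) &
      forall k, (k < size l)%N ->
        let p := nth (false, 0) l k in
        [/\ legal (expr_at ns k), eeval rho (expr_at ns k) = p.2
          & p.1 -> variable_free (expr_at ns k)]].

Lemma realizes_rcons ns l g (p : bool * R) :
  realizes ns l -> all (fun i => i < size ns)%N (inputs g) ->
  small_const g -> legal_gate ns g -> (is_div g -> dv) ->
  let e := unfold_gate (exprs ns) g in
  [/\ legal e, eeval rho e = p.2 & p.1 -> variable_free e] ->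
  realizes (rcons ns g) (rcons l p).
Proof.
case=> -[eq_sz top] sm leg dvn vals ing smg legg dvg e he.
have leg_rcons h : all (fun i => i < size ns)%N (inputs h) ->
    legal_gate (rcons ns g) h = legal_gate ns h.
  by case: h => //= i j /and3P[_ lt_j _]; rewrite expr_at_rcons.
split.
- by rewrite !size_rcons eq_sz; split=> //; apply/topological_rcons.
- by rewrite all_rcons smg.
- move=> k; rewrite size_rcons ltnS leq_eqVlt nth_rcons => /predU1P[-> | lt_k].
    by rewrite ltnn eqxx leg_rcons.
  rewrite lt_k leg_rcons ?leg //; apply: sub_all (top _ lt_k) => i lt_i.
  exact: ltn_trans lt_k.
- by rewrite has_rcons => /orP[].
- move=> k; rewrite size_rcons ltnS leq_eqVlt nth_rcons => /predU1P[-> | lt_k].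
    by rewrite ltnn eqxx -eq_sz expr_at_last.
  by rewrite lt_k expr_at_rcons ?eq_sz //; apply: vals.
Qed.

(** A program names its operands by flag and value, a circuit by position; the position taken is the
    first occurrence of the operand in the list. *)
Lemma slp_realized l : slp l -> exists ns, realizes ns l.
Proof.
have find l' (ns : seq (gate V)) u : realizes ns l' -> u \in l' ->
    exists2 i, (i < size ns)%N &
      [/\ legal (expr_at ns i), eeval rho (expr_at ns i) = u.2
        & u.1 -> variable_free (expr_at ns i)].
  case=> -[eq_sz _] _ _ _ vals u_l.
  have lt_i : (index u l' < size l')%N by rewrite index_mem.
  by exists (index u l'); rewrite ?eq_sz //; have := vals _ lt_i; rewrite nth_index.
elim=> {l} [|l v _ [ns hns]|l c _ [ns hns] sc|l u w _ [ns hns] ul wl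
  |l u w _ [ns hns] ul wl|l u w _ [ns hns] ul wl hdv w1 nz].
- by exists [::]; split.
- by exists (rcons ns (Var v)); apply: realizes_rcons.
- by exists (rcons ns (Const c)); apply: realizes_rcons.
- have [i lt_i [li ei vi]] := find _ _ _ hns ul.
  have [j lt_j [lj ej vj]] := find _ _ _ hns wl.
  exists (rcons ns (Add i j)); apply: realizes_rcons => //=; first exact/and3P.
  by rewrite -!/(expr_at _ _) li lj ei ej; split=> // /andP[/vi-> /vj->].
- have [i lt_i [li ei vi]] := find _ _ _ hns ul.
  have [j lt_j [lj ej vj]] := find _ _ _ hns wl.
  exists (rcons ns (Mul i j)); apply: realizes_rcons => //=; first exact/and3P.
  by rewrite -!/(expr_at _ _) li lj ei ej; split=> // /andP[/vi-> /vj->].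
- have [i lt_i [li ei vi]] := find _ _ _ hns ul.
  have [j lt_j [lj ej vj]] := find _ _ _ hns wl.
  (* The flag certifies a variable-free denominator, so its value in [R] is the image of a rational,
     and that rational cannot be 0. *)
  have nz0 : eeval (fun _ => 0 : rat) (expr_at ns j) != 0.
    apply: contra nz => /eqP e0; rewrite -ej (eeval_variable_free iota) ?vj //.
    by rewrite e0 rmorph0.
  exists (rcons ns (Div i j)); apply: realizes_rcons => //=.
  + exact/and3P.
  + by rewrite vj.
  + rewrite -!/(expr_at _ _) li lj ei ej vj ?nz0 //.
    by split=> // /andP[/vi->].
Qed.

Lemma slp_circuit l p : slp l -> p \in l ->
  exists C : circuit V,
    [/\ constant_free C, csize C = size l, ceval rho C = p.2
      & has (@is_div V) (nodes C) -> dv].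
Proof.
case/slp_realized=> ns [[eq_sz top] sm leg dvn vals] p_l.
have lt_i : (index p l < size l)%N by rewrite index_mem.
exists (Circuit ns (index p l)); split=> //.
- apply/and3P; split=> //; first by apply: well_formedI; rewrite ?/csize ?eq_sz.
  by apply/(all_nthP (Const 0)) => k lt_k; apply: leg.
- by have [_] := vals _ lt_i; rewrite nth_index.
Qed.

(** A Hoare triple with a budget of [k] nodes: the program may only be extended, so whatever was
    known stays known, and budgets add up under [grow_bind]. *)
Definition grow l k (Q : seq (bool * R) -> Prop) :=
  exists l', [/\ slp l', {subset l <= l'}, (size l' <= size l + k)%N & Q l'].

Definition knows l v := v \in unzip2 l.

(** The flag is kept beside the value because it licenses a later division by that value. *)
Definition sim V' (rho' : V' -> R) l (e : expr V') :=
  exists2 f, (f, eeval rho' e) \in l & variable_free e -> f.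

Lemma knowsP l v : reflect (exists f, (f, v) \in l) (knows l v).
Proof.
apply: (iffP mapP) => [[[f w] fl /= ->] | [f fl]]; first by exists f.
by exists (f, v).
Qed.

Lemma knows_sub l l' v : {subset l <= l'} -> knows l v -> knows l' v.
Proof. by move=> sub /knowsP[f fl]; apply/knowsP; exists f; apply: sub. Qed.

Lemma sim_knows V' (rho' : V' -> R) l e : sim rho' l e -> knows l (eeval rho' e).
Proof. by case=> f fl _; apply/knowsP; exists f. Qed.

Lemma sim_sub V' (rho' : V' -> R) l l' e :
  {subset l <= l'} -> sim rho' l e -> sim rho' l' e.
Proof. by move=> sub [f fl vf]; exists f; first exact: sub. Qed.

Lemma grow_refl l (Q : seq (bool * R) -> Prop) k : slp l -> Q l -> grow l k Q.
Proof. by exists l; split; rewrite ?leq_addr. Qed.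

Lemma grow_rcons l p (Q : seq (bool * R) -> Prop) :
  slp (rcons l p) -> Q (rcons l p) -> grow l 1 Q.
Proof.
exists (rcons l p); split=> //; last by rewrite size_rcons addn1.
by move=> x xl; rewrite mem_rcons inE xl orbT.
Qed.

Lemma grow_bind l k1 k2 k (Q1 Q2 : seq (bool * R) -> Prop) :
  grow l k1 Q1 -> (k1 + k2 <= k)%N ->
  (forall l', slp l' -> {subset l <= l'} -> Q1 l' -> grow l' k2 Q2) ->
  grow l k Q2.
Proof.
case=> l1 [s1 sub1 sz1 q1] le_k /(_ _ s1 sub1 q1)[l2 [s2 sub2 sz2 q2]].
exists l2; split=> //; first by move=> x /sub1/sub2.
by rewrite (leq_trans sz2) // (leq_trans (leq_add sz1 (leqnn _))) // -addnA leq_add2l.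
Qed.

Lemma grow_weaken l k1 k (Q1 Q2 : seq (bool * R) -> Prop) :
  grow l k1 Q1 -> (k1 <= k)%N ->
  (forall l', slp l' -> {subset l <= l'} -> Q1 l' -> Q2 l') -> grow l k Q2.
Proof.
move=> g le_k q; apply: (grow_bind g (k2 := 0)); rewrite ?addn0 // => l' s' sub q1.
exact/grow_refl/q.
Qed.

Section Simulation.
Variables (V' : Type) (rho' : V' -> R).

Lemma sim_const l c : slp l -> c \in [:: 0; 1; -1] ->
  grow l 1 (fun l' => sim rho' l' (EConst c)).
Proof.
move=> sl sc; apply: (grow_rcons (slp_const sl sc)).
by exists true; rewrite ?mem_rcons ?mem_head.
Qed.

Lemma sim_add l a b : slp l -> sim rho' l a -> sim rho' l b ->
  grow l 1 (fun l' => sim rho' l' (EAdd a b)).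
Proof.
move=> sl [f fl vf] [g gl vg]; apply: (grow_rcons (slp_add sl fl gl)) => /=.
by exists (f && g); rewrite ?mem_rcons ?mem_head //= => /andP[/vf-> /vg->].
Qed.

Lemma sim_mul l a b : slp l -> sim rho' l a -> sim rho' l b ->
  grow l 1 (fun l' => sim rho' l' (EMul a b)).
Proof.
move=> sl [f fl vf] [g gl vg]; apply: (grow_rcons (slp_mul sl fl gl)) => /=.
by exists (f && g); rewrite ?mem_rcons ?mem_head //= => /andP[/vf-> /vg->].
Qed.

Lemma sim_div l a b : dv -> slp l -> legal (EDiv a b) ->
  sim rho' l a -> sim rho' l b ->
  grow l 1 (fun l' => sim rho' l' (EDiv a b)).
Proof.
move=> hdv sl /and4P[_ lb vfb nz] [f fl vf] [g gl vg].
have nzb : eeval rho' b != 0.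
  rewrite (eeval_variable_free iota) //; apply: contra nz => /eqP b0.
  by rewrite -(fmorph_eq0 iota) b0.
apply: (grow_rcons (slp_div sl fl gl hdv (vg vfb) nzb)) => /=.
by exists (f && g); rewrite ?mem_rcons ?mem_head //= => /andP[/vf-> /vg->].
Qed.

(** Inserts a whole circuit with its variables bound to values already known; this is how the
    refutation of the binary value principle enters. *)
Lemma sim_circuit l (B : circuit V') : dv -> slp l -> constant_free B ->
  (forall v, knows l (rho' v)) ->
  grow l (csize B) (fun l' => knows l' (ceval rho' B)).
Proof.
move=> hdv sl cfB kv.
have [/topologicalP[lt_o top] sm _] := and3P cfB.
suff all_nodes k : (k <= csize B)%N ->
    grow l k (fun l' => forall i, (i < k)%N -> sim rho' l' (expr_at (nodes B) i)).
  apply: grow_weaken (all_nodes _ (leqnn _)) _ _ => // l' _ _ h.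
  exact/sim_knows/h.
elim: k => [|k IH] lt_k; first exact: grow_refl.
apply: (grow_bind (IH (ltnW lt_k)) (k2 := 1)); first by rewrite addn1.
move=> l1 s1 sub1 h1.
suff g : grow l1 1 (fun l' => sim rho' l' (expr_at (nodes B) k)).
  apply: grow_weaken g _ _ => // l2 s2 sub2 h2 i.
  rewrite ltnS leq_eqVlt => /predU1P[-> // | /h1]; exact: sim_sub.
have := legal_at cfB lt_k; have := (all_nthP (Const 0) sm) _ lt_k.
have := top _ lt_k; rewrite expr_atE //.
case: (nth _ _ k) => /= [v|c|i j|i j|i j] => [_|_|/and3P[li lj _]|/and3P[li lj _]
  |/and3P[li lj _]] sc lg.
- have /knowsP[f fl] := kv v; apply: grow_refl => //.
  by exists f => //; apply: sub1.
- exact: sim_const.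
- by apply: sim_add => //; apply: h1.
- by apply: sim_mul => //; apply: h1.
- by apply: sim_div => //; apply: h1.
Qed.

End Simulation.

(** Variables stand for values that the program already contains, hence cost 0. *)
Fixpoint esize (e : expr R) : nat :=
  match e with
  | EVar _ => 0
  | EConst _ => 1
  | EAdd a b | EMul a b | EDiv a b => (esize a + esize b).+1
  end.

Fixpoint formula l (e : expr R) : Prop :=
  match e with
  | EVar v => knows l v
  | EConst c => c \in [:: 0; 1; -1]
  | EAdd a b | EMul a b => formula l a /\ formula l b
  | EDiv _ _ => False
  end.

Lemma formula_sub l l' e : {subset l <= l'} -> formula l e -> formula l' e.
Proof.
move=> sub; elim: e => //= [v|a IHa b IHb [/IHa ? /IHb]|a IHa b IHb [/IHa ? /IHb]] //.
exact: knows_sub.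
Qed.

Lemma knows_add l u w : slp l -> knows l u -> knows l w ->
  grow l 1 (fun l' => knows l' (u + w)).
Proof.
move=> sl /knowsP[f fl] /knowsP[g gl]; apply: (grow_rcons (slp_add sl fl gl)).
by apply/knowsP; exists (f && g); rewrite mem_rcons mem_head.
Qed.

Lemma knows_mul l u w : slp l -> knows l u -> knows l w ->
  grow l 1 (fun l' => knows l' (u * w)).
Proof.
move=> sl /knowsP[f fl] /knowsP[g gl]; apply: (grow_rcons (slp_mul sl fl gl)).
by apply/knowsP; exists (f && g); rewrite mem_rcons mem_head.
Qed.

(** Turns an explicit ring identity into program nodes: each derivation below is a formula [e] over
    known values, and its correctness is left to [ring]. *)
Lemma grow_formula l e v k : slp l -> formula l e -> eeval id e = v ->
  (esize e <= k)%N -> grow l k (fun l' => knows l' v).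
Proof.
move=> sl fe <- le_k.
suff g : grow l (esize e) (fun l' => knows l' (eeval id e)).
  exact: grow_weaken g le_k _.
elim: e l sl fe {le_k} => //= [w|c|a IHa b IHb|a IHa b IHb] l sl.
- by move=> kv; apply: grow_refl.
- move=> sc; apply: grow_weaken (sim_const id sl sc) _ _ => // l' _ _.
  exact: sim_knows.
- case=> fa fb; apply: (grow_bind (IHa _ sl fa) (k2 := (esize b + 1)%N))
    => [|l1 s1 sub1 ka].
    by rewrite addnA addn1.
  apply: (grow_bind (IHb _ s1 (formula_sub sub1 fb))) => // l2 s2 sub2 kb.
  by apply: knows_add => //; apply: knows_sub ka.
- case=> fa fb; apply: (grow_bind (IHa _ sl fa) (k2 := (esize b + 1)%N))
    => [|l1 s1 sub1 ka].
    by rewrite addnA addn1.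
  apply: (grow_bind (IHb _ s1 (formula_sub sub1 fb))) => // l2 s2 sub2 kb.
  by apply: knows_mul => //; apply: knows_sub ka.
Qed.

Lemma grow_neg l x : slp l -> knows l x -> grow l 2 (fun l' => knows l' (- x)).
Proof.
move=> sl kx.
apply: (@grow_formula _ (EMul (EConst (-1)) (EVar x))) => //=.
by rewrite mulrN1z mulN1r.
Qed.

End StraightLine.

(** * Binary arithmetic with derivations *)

Section BitVectors.
Variables (V : Type) (A : comUnitRingType) (dv : bool) (rho : V -> (A * A)%type).
Local Notation slp := (slp dv rho).
Local Notation grow := (grow dv rho).
Implicit Types (l : seq (bool * (A * A))) (a b c : A) (s p q : seq A).

(** [diag a] takes the value a under both substitutions, as a polynomial in x alone does; [dev a] is
    the value of an IPS proof of a. *)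
Definition diag a : (A * A)%type := (a, a).
Definition dev a : (A * A)%type := (0, a).

(* The dev component is an IPS derivation of b^2 - b from the boolean axioms. *)
Definition isbit l b := knows l (diag b) /\ knows l (dev (b * b - b)).

Definition bits l s := {in s, forall b, isbit l b}.

Definition has_bits01 l := isbit l 0 /\ isbit l 1.

(* Least significant bit first. *)
Fixpoint val2 s : A := if s is b :: s' then b + 2 * val2 s' else 0.

Lemma isbit_sub l l' b : {subset l <= l'} -> isbit l b -> isbit l' b.
Proof. by move=> sub [kb kd]; split; apply: knows_sub; eassumption. Qed.

Lemma bits_sub l l' s : {subset l <= l'} -> bits l s -> bits l' s.
Proof. by move=> sub hs b /hs; apply: isbit_sub. Qed.

Lemma has_bits01_sub l l' : {subset l <= l'} -> has_bits01 l -> has_bits01 l'.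
Proof. by move=> sub [h0 h1]; split; apply: isbit_sub; eassumption. Qed.

Lemma bits_cons l b s : bits l (b :: s) <-> isbit l b /\ bits l s.
Proof.
split=> [h | [hb hs] c]; last by rewrite inE => /predU1P[-> | /hs].
by split=> [|c cs]; apply: h; rewrite inE ?eqxx ?cs ?orbT.
Qed.

Lemma bits_nil l : bits l [::].
Proof. by []. Qed.

Lemma bits_cat l s s' : bits l s -> bits l s' -> bits l (s ++ s').
Proof. by move=> h h' b; rewrite mem_cat => /orP[/h | /h']. Qed.

Lemma val2_cat s s' : val2 (s ++ s') = val2 s + 2 ^+ size s * val2 s'.
Proof.
elim: s => /= [|b s ->]; first by rewrite expr0 mul1r add0r.
by rewrite exprS; ring.
Qed.

Lemma bits_pad l s w : has_bits01 l -> bits l s -> (size s <= w)%N ->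
  exists s', [/\ size s' = w, bits l s' & val2 s' = val2 s].
Proof.
case=> h0 _ hs le_w; exists (s ++ nseq (w - size s) 0); split.
- by rewrite size_cat size_nseq subnKC.
- by apply: bits_cat => // b /nseqP[-> _].
- rewrite val2_cat; set z := val2 (nseq _ _); have -> : z = 0.
    by rewrite /z; elim: (w - _)%N => //= k ->; rewrite mulr0 addr0.
  by rewrite mulr0 addr0.
Qed.

Lemma bits_nat l w m : has_bits01 l -> (m < 2 ^ w)%N ->
  exists s, [/\ size s = w, bits l s & val2 s = m%:R].
Proof.
move=> [h0 h1]; elim: w m => [|w IH] m lt_m.
  by exists [::]; split=> //; case: m lt_m.
have [|s [sz hs vs]] := IH m./2; first by move: lt_m; rewrite expnS; lia.
exists ((odd m)%:R :: s); split; first by rewrite /= sz.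
  by apply/bits_cons; split=> //; case: (odd m).
by rewrite /= vs -natrM -natrD mul2n odd_double_half.
Qed.

Lemma pair_ext (x : A * A) a b : x.1 = a -> x.2 = b -> x = (a, b).
Proof. by case: x => /= ? ? -> ->. Qed.

Lemma fst_add (x y : A * A) : (x + y).1 = x.1 + y.1. Proof. by []. Qed.
Lemma snd_add (x y : A * A) : (x + y).2 = x.2 + y.2. Proof. by []. Qed.
Lemma fst_mul (x y : A * A) : (x * y).1 = x.1 * y.1. Proof. by []. Qed.
Lemma snd_mul (x y : A * A) : (x * y).2 = x.2 * y.2. Proof. by []. Qed.
Lemma fst_opp (x : A * A) : (- x).1 = - x.1. Proof. by []. Qed.
Lemma snd_opp (x : A * A) : (- x).2 = - x.2. Proof. by []. Qed.
Lemma fst_one : (1 : A * A).1 = 1. Proof. by []. Qed.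
Lemma snd_one : (1 : A * A).2 = 1. Proof. by []. Qed.

Definition pairE := (fst_add, snd_add, fst_mul, snd_mul, fst_opp, snd_opp,
  fst_one, snd_one).

Local Notation one := (EConst 1).
Local Notation neg e := (EMul (EConst (-1)) e).
Local Notation var x := (EVar x).

Ltac pair_ring :=
  rewrite /= ?mulr1z ?mulrN1z; apply: pair_ext; rewrite ?pairE /=; ring.

Ltac formula_by e :=
  apply: (@grow_formula _ _ _ _ _ e);
  [by [] | by rewrite /=; intuition | by rewrite /diag /dev; pair_ring | by []].

Lemma grow_isbit l b k1 k2 : slp l ->
  grow l k1 (fun l' => knows l' (diag b)) ->
  (forall l', slp l' -> {subset l <= l'} -> knows l' (diag b) ->
     grow l' k2 (fun l'' => knows l'' (dev (b * b - b)))) ->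
  grow l (k1 + k2) (fun l' => isbit l' b).
Proof.
move=> sl g1 g2; apply: (grow_bind g1 (leqnn _)) => l1 s1 sub1 kb.
apply: grow_weaken (g2 _ s1 sub1 kb) (leqnn _) _ => l2 s2 sub2 kd.
by split=> //; apply: knows_sub kb.
Qed.

Lemma bit_not l a : slp l -> isbit l a -> grow l 4 (fun l' => isbit l' (1 - a)).
Proof.
move=> sl [ka kd]; apply: (@grow_isbit _ _ 4 0) => //.
  formula_by (EAdd one (neg (var (diag a)))).
move=> l1 s1 sub1 _; have kd1 := knows_sub sub1 kd.
formula_by (var (dev (a * a - a))).
Qed.

Lemma bit_and l a b : slp l -> isbit l a -> isbit l b ->
  grow l 10 (fun l' => isbit l' (a * b)).
Proof.
move=> sl [ka kda] [kb kdb]; apply: (@grow_isbit _ _ 4 6) => //.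
  formula_by (EMul (var (diag a)) (var (diag b))).
move=> l1 s1 sub1 _; have [ka1 kb1] := (knows_sub sub1 ka, knows_sub sub1 kb).
have [kda1 kdb1] := (knows_sub sub1 kda, knows_sub sub1 kdb).
formula_by (EAdd (EMul (var (dev (a * a - a))) (EMul (var (diag b)) (var (diag b))))
  (EMul (var (diag a)) (var (dev (b * b - b))))).
Qed.

Lemma bit_xor l a b : slp l -> isbit l a -> isbit l b ->
  grow l 30 (fun l' => isbit l' (a + b - 2 * a * b)).
Proof.
move=> sl [ka kda] [kb kdb]; apply: (@grow_isbit _ _ 10 20) => //.
  formula_by (EAdd (EAdd (var (diag a)) (var (diag b)))
    (neg (EMul (EAdd one one) (EMul (var (diag a)) (var (diag b)))))).
move=> l1 s1 sub1 _; have [ka1 kb1] := (knows_sub sub1 ka, knows_sub sub1 kb).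
have [kda1 kdb1] := (knows_sub sub1 kda, knows_sub sub1 kdb).
(* The xor equals a u + b with u = 1 - 2 b; in its square the remaining terms are a u (u + 2 b - 1)
   = 0. *)
pose u := EAdd one (neg (EAdd (var (diag b)) (var (diag b)))).
formula_by (EAdd (EMul (EMul u u) (var (dev (a * a - a)))) (var (dev (b * b - b)))).
Qed.

(** With h the xor of a and b, the sum bit is the xor of h and c, and the carry is a b + c h. The
    adder equation then holds for arbitrary polynomials, so only the booleanity of the new bits
    costs derivations. *)
Lemma full_adder l a b c : slp l -> isbit l a -> isbit l b -> isbit l c ->
  grow l 200 (fun l' => exists x co : A,
    [/\ isbit l' x, isbit l' co & x + 2 * co = a + b + c]).
Proof.
move=> sl ha hb hc.
apply: (grow_bind (bit_xor sl ha hb) (k2 := 170)) => // l1 s1 sub1 hh.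
set h := a + b - _ in hh.
apply: (grow_bind (bit_xor s1 hh (isbit_sub sub1 hc)) (k2 := 140)) => // l2 s2 sub2 hs.
have {}ha := isbit_sub sub2 (isbit_sub sub1 ha).
have {}hb := isbit_sub sub2 (isbit_sub sub1 hb).
have {}hc := isbit_sub sub2 (isbit_sub sub1 hc).
have {}hh := isbit_sub sub2 hh.
apply: (grow_bind (bit_and s2 ha hb) (k2 := 130)) => // l3 s3 sub3 hu.
apply: (grow_bind (bit_and s3 (isbit_sub sub3 hc) (isbit_sub sub3 hh)) (k2 := 120))
  => // l4 s4 sub4 hw.
have sub := fun x h2 => sub4 x (sub3 x h2).
have {}hu := isbit_sub sub4 hu.
suff g : grow l4 120 (fun l' => isbit l' (a * b + c * h)).
  apply: grow_weaken g _ _ => // l5 s5 sub5 hco.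
  exists (h + c - 2 * h * c), (a * b + c * h); split=> //.
    exact: isbit_sub (fun x h2 => sub5 x (sub x h2)) hs.
  by rewrite /h; ring.
have [[ka kda] [kb kdb] [kc _]] :=
  And3 (isbit_sub sub ha) (isbit_sub sub hb) (isbit_sub sub hc).
have [[ku kdu] [kw kdw]] := (hu, hw).
apply: (@grow_isbit _ _ 60 60) => //.
  formula_by (EAdd (var (diag (a * b))) (var (diag (c * h)))).
move=> l5 s5 sub5 _.
have [{}ka {}kb] := (knows_sub sub5 ka, knows_sub sub5 kb).
have [{}kda {}kdb] := (knows_sub sub5 kda, knows_sub sub5 kdb).
have [{}kdu {}kdw] := (knows_sub sub5 kdu, knows_sub sub5 kdw).
have {}kc := knows_sub sub5 kc.
(* (u + w)^2 - (u + w) = (u^2 - u) + (w^2 - w) + 2 u w, and u w = a b h c where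
   a b h lies in the ideal of a^2 - a and b^2 - b. *)
pose x := EMul (var (dev (a * a - a))) (var (diag b)).
pose y := EMul (var (diag a)) (var (dev (b * b - b))).
pose z := EMul (var (dev (a * a - a))) (var (dev (b * b - b))).
pose v := EMul (var (diag c)) (EAdd (EAdd x y) (EAdd z z)).
rewrite /h in kdu kdw *.
formula_by (EAdd (EAdd (var (dev (a * b * (a * b) - a * b)))
   (var (dev (c * (a + b - 2 * a * b) * (c * (a + b - 2 * a * b))
             - c * (a + b - 2 * a * b)))))
   (neg (EAdd v v))).
Qed.

Lemma adder l p q c : slp l -> size p = size q -> bits l p -> bits l q ->
  isbit l c ->
  grow l (200 * size p) (fun l' => exists s co,
    [/\ size s = size p, bits l' s, isbit l' co
      & val2 s + 2 ^+ size p * co = val2 p + val2 q + c]).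
Proof.
elim: p q l c => [|a p IH] [|b q] l c sl //= sz hp hq hc.
  by apply: grow_refl => //; exists [::], c; split=> //=; ring.
case: sz => sz; have [ha {}hp] := (bits_cons _ _ _).1 hp.
have [hb {}hq] := (bits_cons _ _ _).1 hq.
apply: (grow_bind (full_adder sl ha hb hc) (k2 := 200 * size p)%N).
  by rewrite mulnS.
move=> l1 s1 sub1 [s [c1 [hs hc1 e1]]].
apply: grow_weaken (IH _ _ c1 s1 sz (bits_sub sub1 hp) (bits_sub sub1 hq) hc1) _ _ => //.
move=> l2 s2 sub2 [ss [co [sz2 hss hco e2]]].
exists (s :: ss), co; split=> //=; first by rewrite sz2.
  by apply/bits_cons; split=> //; apply: isbit_sub hs.
have -> : val2 ss = val2 p + val2 q + c1 - 2 ^+ size p * co by rewrite -e2 addrK.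
have -> : s = a + b + c - 2 * c1 by rewrite -e1 addrK.
by rewrite exprS; ring.
Qed.

Lemma adder_rcons l p q c : slp l -> size p = size q -> bits l p -> bits l q ->
  isbit l c ->
  grow l (200 * size p) (fun l' => exists s,
    [/\ size s = (size p).+1, bits l' s & val2 s = val2 p + val2 q + c]).
Proof.
move=> sl sz hp hq hc; apply: grow_weaken (adder sl sz hp hq hc) _ _ => //.
move=> l' s' sub [s [co [szs hs hco e]]]; exists (s ++ [:: co]); split.
- by rewrite size_cat szs addn1.
- by apply: bits_cat => //; apply/bits_cons.
- by rewrite val2_cat szs /= mulr0 addr0.
Qed.

Lemma bits_add l p q w : slp l -> has_bits01 l -> bits l p -> bits l q ->
  (size p <= w)%N -> (size q <= w)%N ->
  grow l (200 * w) (fun l' => exists s,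
    [/\ size s = w.+1, bits l' s & val2 s = val2 p + val2 q]).
Proof.
move=> sl h01 hp hq szp szq; have [p' [sp hp' <-]] := bits_pad h01 hp szp.
have [q' [sq hq' <-]] := bits_pad h01 hq szq; rewrite -sp.
have [h0 _] := h01.
apply: grow_weaken (adder_rcons sl _ hp' hq' h0) _ _ => [||l' _ _ [s [? ? e]]].
- by rewrite sp sq.
- by [].
- by exists s; split=> //; rewrite e addr0.
Qed.

Lemma bits_map l s k (f : A -> A) (P : seq (bool * (A * A)) -> Prop) : slp l ->
  bits l s -> P l ->
  (forall l1 l2, {subset l1 <= l2} -> P l1 -> P l2) ->
  (forall l' b, slp l' -> P l' -> isbit l' b ->
     grow l' k (fun l'' => isbit l'' (f b))) ->
  grow l (k * size s) (fun l' => bits l' (map f s)).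
Proof.
move=> sl hs Pl mon g; elim: s l sl hs Pl => [|b s IH] l sl hs Pl /=.
  exact: grow_refl.
have [hb {}hs] := (bits_cons _ _ _).1 hs.
apply: (grow_bind (g _ _ sl Pl hb) (k2 := k * size s)%N); first by rewrite mulnS.
move=> l1 s1 sub1 hfb.
apply: grow_weaken (IH _ s1 (bits_sub sub1 hs) (mon _ _ sub1 Pl)) _ _ => //.
by move=> l2 s2 sub2 hfs; apply/bits_cons; split=> //; apply: isbit_sub hfb.
Qed.

Lemma bits_not l s : slp l -> bits l s ->
  grow l (4 * size s) (fun l' => bits l' [seq 1 - b | b <- s]).
Proof.
move=> sl hs; apply: (bits_map (P := fun=> True)) => // l' b s' _.
exact: bit_not.
Qed.

Lemma bits_and l a s : slp l -> isbit l a -> bits l s ->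
  grow l (10 * size s) (fun l' => bits l' [seq a * b | b <- s]).
Proof.
move=> sl ha hs; apply: (bits_map (P := isbit^~ a)) => //.
  by move=> l1 l2; apply: isbit_sub.
by move=> l' b s'; apply: bit_and.
Qed.

Lemma bits_xor l a s : slp l -> isbit l a -> bits l s ->
  grow l (30 * size s) (fun l' => bits l' [seq a + b - 2 * a * b | b <- s]).
Proof.
move=> sl ha hs; apply: (bits_map (P := isbit^~ a)) => //.
  by move=> l1 l2; apply: isbit_sub.
by move=> l' b s'; apply: bit_xor.
Qed.

Lemma val2_not s : val2 [seq 1 - b | b <- s] = 2 ^+ size s - 1 - val2 s.
Proof. by elim: s => /= [|b s ->]; rewrite ?exprS; ring. Qed.

Lemma val2_and a s : val2 [seq a * b | b <- s] = a * val2 s.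
Proof. by elim: s => /= [|b s ->]; ring. Qed.

Lemma val2_xor a s : val2 [seq a + b - 2 * a * b | b <- s] =
  (1 - 2 * a) * val2 s + a * (2 ^+ size s - 1).
Proof. by elim: s => /= [|b s ->]; rewrite ?exprS; ring. Qed.

(* Shift-and-add with an accumulator of the width of [q], which keeps the
   result within [size p + size q] bits. *)
Lemma bits_mul_acc l p q h : slp l -> bits l p -> bits l q -> bits l h ->
  has_bits01 l -> size h = size q ->
  grow l (210 * (size p * size q)) (fun l' => exists s,
    [/\ size s = (size p + size q)%N, bits l' s
      & val2 s = val2 p * val2 q + val2 h]).
Proof.
elim: p l h => [|a p IH] l h sl hp hq hh h01 sz.
  by apply: grow_refl => //; exists h; split=> //=; ring.
have [ha {}hp] := (bits_cons _ _ _).1 hp.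
apply: (grow_bind (bits_and sl ha hq) (k2 := 200 * size q + 210 * (size p * size q))%N).
  by rewrite /=; lia.
move=> l1 s1 sub1 haq; have [h0 _] := has_bits01_sub sub1 h01.
have sz1 : size [seq a * b | b <- q] = size h by rewrite size_map.
have g := adder_rcons s1 sz1 haq (bits_sub sub1 hh) h0.
apply: (grow_bind g (k2 := 210 * (size p * size q))%N).
  by rewrite size_map.
(* The lowest bit [b] of the partial sum is final; the other bits, as many as in [q], form the
   accumulator for the next bit of [p]. *)
move=> l2 s2 sub2 [[|b s] [szs hs es]] //; case: szs; rewrite size_map => szs.
have [hb {}hs] := (bits_cons _ _ _).1 hs.
have sub := fun x h2 => sub2 x (sub1 x h2).
have {}g := IH _ s s2 (bits_sub sub hp) (bits_sub sub hq) hs (has_bits01_sub sub h01) szs.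
apply: grow_weaken g _ _ => // l3 s3 sub3 [ss [szss hss e]].
exists (b :: ss); split=> /=; first by rewrite szss.
  by apply/bits_cons; split=> //; apply: isbit_sub hb.
move: es; rewrite /= e val2_and addr0 => es.
have -> : b = a * val2 q + val2 h - 2 * val2 s by rewrite -es addrK.
by ring.
Qed.

Lemma bits_mul l p q w1 w2 : slp l -> has_bits01 l -> bits l p -> bits l q ->
  (size p <= w1)%N -> (size q <= w2)%N ->
  grow l (210 * (w1 * w2)) (fun l' => exists s,
    [/\ (size s <= w1 + w2)%N, bits l' s & val2 s = val2 p * val2 q]).
Proof.
move=> sl h01 hp hq szp szq.
have [h [szh hh vh]] := bits_pad h01 (@bits_nil l) (leq0n (size q)).
apply: grow_weaken (bits_mul_acc sl hp hq hh h01 szh) _ _.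
  by rewrite leq_mul2l leq_mul.
move=> l' _ _ [s [szs hs e]]; exists s; split=> //.
  by rewrite szs leq_add.
by rewrite e vh addr0.
Qed.

Lemma bits_val l s : slp l -> has_bits01 l -> bits l s ->
  grow l (4 * size s) (fun l' => knows l' (diag (val2 s))).
Proof.
move=> sl [[k0 _] _] hs; elim: s l sl k0 hs => [|b s IH] l sl k0 hs /=.
  exact: grow_refl.
have [hb {}hs] := (bits_cons _ _ _).1 hs.
apply: (grow_bind (IH _ sl k0 hs) (k2 := 4)); first by rewrite mulnS addnC.
move=> l1 s1 sub1 kv; have [kb _] := isbit_sub sub1 hb.
formula_by (EAdd (var (diag b)) (EAdd (var (diag (val2 s))) (var (diag (val2 s))))).
Qed.

(** Adding q to the complement of p gives s + 2^w bt = 2^w - 1 - p + q, so on 0/1 values bt = 1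
    exactly when p < q. Complementing s, xoring with bt and adding bt yields the absolute value of p
    - q. Only squares are compared, since the sign varies with x; their difference is a multiple of
    bt^2 - bt. *)
Lemma bits_abs l p q w : slp l -> has_bits01 l -> bits l p -> bits l q ->
  (size p <= w)%N -> (size q <= w)%N ->
  grow l (1000 * w + 100) (fun l' => exists s,
    [/\ (size s <= w.+1)%N, bits l' s &
      knows l' (dev ((val2 p - val2 q) ^+ 2 - val2 s ^+ 2))]).
Proof.
move=> sl h01 hp hq szp szq; have [p' [sp hp' <-]] := bits_pad h01 hp szp.
have [q' [sq hq' <-]] := bits_pad h01 hq szq.
move: {hp hq szp szq} p' q' sp sq hp' hq' => {}p {}q sp sq hp hq.
apply: (grow_bind (bits_not sl hp) (k2 := 996 * w + 100)%N).
  by rewrite sp; lia.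
move=> l1 s1 sub1 hnp; have [h0 _] := has_bits01_sub sub1 h01.
have g := adder s1 (etrans (size_map _ _) (etrans sp (esym sq))) hnp (bits_sub sub1 hq) h0.
apply: (grow_bind g (k2 := 796 * w + 100)%N); first by rewrite size_map sp; lia.
move=> l2 s2 sub2 [s [bt [szs hs hbt e]]].
rewrite size_map sp in szs; rewrite size_map sp in e.
apply: (grow_bind (bits_not s2 hs) (k2 := 792 * w + 100)%N); first by rewrite szs; lia.
move=> l3 s3 sub3 hns.
have g3 := bits_xor s3 (isbit_sub sub3 hbt) hns.
apply: (grow_bind g3 (k2 := 762 * w + 100)%N); first by rewrite size_map szs; lia.
move=> l4 s4 sub4; set d := map _ _ => hd.
have szd : size d = w by rewrite !size_map.
have sub14 := fun x h2 => sub4 x (sub3 x (sub2 x (sub1 x h2))).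
have sub24 := fun x h2 => sub4 x (sub3 x h2).
have [z [szz hz vz]] :=
  bits_pad (has_bits01_sub sub14 h01) (@bits_nil l4) (leq0n (size d)).
have g4 := adder_rcons s4 (esym szz) hd hz (isbit_sub sub24 hbt).
apply: (grow_bind g4 (k2 := 562 * w + 100)%N); first by rewrite szd; lia.
move=> l5 s5 sub5 [r [szr hr vr]].
have sub15 := fun x h2 => sub5 x (sub14 x h2).
have h015 := has_bits01_sub sub15 h01.
apply: (grow_bind (bits_val s5 h015 (bits_sub sub15 hp)) (k2 := 558 * w + 100)%N).
  by rewrite sp; lia.
move=> l6 s6 sub6 kp.
have sub16 := fun x h2 => sub6 x (sub15 x h2).
have h016 := has_bits01_sub sub16 h01.
apply: (grow_bind (bits_val s6 h016 (bits_sub sub16 hq)) (k2 := 554 * w + 100)%N).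
  by rewrite sq; lia.
move=> l7 s7 sub7 kq.
have h017 := has_bits01_sub sub7 h016.
(* The constant 2^w is obtained as the value of a bit string: w zeros followed by a one. *)
have [p2 [szp2 hp2 vp2]] := bits_pad h017 (@bits_nil l7) (leq0n w).
have hp21 : bits l7 (p2 ++ [:: 1]).
  by apply: bits_cat => //; apply/bits_cons; split=> //; case: h017.
apply: (grow_bind (bits_val s7 h017 hp21) (k2 := 550 * w + 96)%N).
  by rewrite size_cat szp2 /=; lia.
move=> l8 s8 sub8; rewrite val2_cat vp2 szp2 add0r /= mulr0 addr0 mulr1 => kpow.
have hr8 := bits_sub (fun x h2 => sub8 x (sub7 x (sub6 x h2))) hr.
apply: (grow_bind (bits_val s8 (has_bits01_sub sub8 h017) hr8) (k2 := 546 * w + 92)%N).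
  by rewrite szr szd; lia.
move=> l9 s9 sub9 kr.
have sub29 := fun x h2 => sub9 x (sub8 x (sub7 x (sub6 x (sub5 x (sub24 x h2))))).
have [kb kdb] := isbit_sub sub29 hbt.
have {}kp := knows_sub (fun x h2 => sub9 x (sub8 x (sub7 x h2))) kp.
have {}kq := knows_sub (fun x h2 => sub9 x (sub8 x h2)) kq.
have {}kpow := knows_sub sub9 kpow.
have {}hr := bits_sub sub9 hr8.
have er : val2 r = (1 - 2 * bt) * (val2 p - val2 q) - 2 * 2 ^+ w * (bt * bt - bt).
  rewrite vr vz /d val2_xor val2_not size_map szs /=.
  have -> : val2 s = val2 [seq 1 - b | b <- p] + val2 q + 0 - 2 ^+ w * bt.
    by rewrite -e addrK.
  by rewrite val2_not sp; move: (2 ^+ w) => tw; ring.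
suff g9 : grow l9 92 (fun l' => knows l' (dev ((val2 p - val2 q) ^+ 2 - val2 r ^+ 2))).
  apply: grow_weaken g9 _ _ => [|l' s' sub' k']; first by lia.
  by exists r; split=> //; [rewrite szr szd | apply: bits_sub hr].
(* With U = (1 - 2 bt)(p - q): (p-q)^2 - U^2 = -4 (bt^2 - bt) (p-q)^2 and
   r = U - 2^(w+1) (bt^2 - bt). *)
pose v := EAdd (var (diag (val2 p))) (neg (var (diag (val2 q)))).
pose k := var (dev (bt * bt - bt)).
pose u := EMul (EAdd one (neg (EAdd (var (diag bt)) (var (diag bt))))) v.
pose k4 := EMul (EAdd k k) (EAdd one one).
pose f1 := neg (EMul k4 (EMul v v)).
pose f2 := EMul (EMul (EAdd one one) (EMul (var (diag (2 ^+ w))) k))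
                (EAdd u (var (diag (val2 r)))).
apply: (@grow_formula _ _ _ _ _ (EAdd f1 f2)); first by [].
- by rewrite /=; intuition.
- rewrite /diag /dev /= ?mulr1z ?mulrN1z; apply: pair_ext; rewrite ?pairE /=.
    by ring.
  by rewrite er; move: (2 ^+ w) => tw; ring.
- by [].
Qed.

End BitVectors.

(** * Syntactic length *)

Section Multipliers.

Fixpoint ival V (e : expr V) : int :=
  match e with
  | EVar _ | EDiv _ _ => 0
  | EConst c => c
  | EAdd a b => ival a + ival b
  | EMul a b => ival a * ival b
  end.

(* The absolute value of the integer computed by [multiplier e]. *)
Fixpoint mult_nat V (e : expr V) : nat :=
  match e with
  | EVar _ | EConst _ => 1
  | EAdd a b | EMul a b => mult_nat a * mult_nat b
  | EDiv a b => mult_nat a * `|ival b|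
  end.

Lemma eeval_ival V (R : unitRingType) (rho : V -> R) e :
  variable_free e -> division_free e -> eeval rho e = (ival e)%:~R.
Proof.
elim: e => //= a IHa b IHb /andP[? ?] /andP[? ?].
  by rewrite intrD IHa ?IHb.
by rewrite intrM IHa ?IHb.
Qed.

Lemma int_length_bound (c : int) :
  (0 < int_length c)%N /\ (`|c| < 2 ^ int_length c)%N.
Proof.
rewrite /int_length; case: ex_minnP => k /andP[k0 /andP[lo hi]] _; split=> //.
have -> : k = k.-1.+1 by rewrite prednK.
have e : (2 ^+ k.-1 : int) = (2 ^ k.-1)%N by rewrite -natrX natz.
move: lo hi; rewrite e expnS; have := expn_gt0 2 k.-1; lia.
Qed.

Lemma ival_bound V (e : expr V) : variable_free e -> division_free e ->
  (`|ival e| < 2 ^ elength e)%N.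
Proof.
elim: e => [//|c _ _|a IHa b IHb|a IHa b IHb|//] /=.
- by have [] := int_length_bound c.
- move=> /andP[va vb] /andP[da db]; have := IHa va da; have := IHb vb db.
  set la := elength a; set lb := elength b => hb ha.
  rewrite expnS.
  have := leq_trans ha (leq_pexp2l (isT : 0 < 2)%N (leq_maxl la lb)).
  have := leq_trans hb (leq_pexp2l (isT : 0 < 2)%N (leq_maxr la lb)).
  by lia.
- move=> /andP[va vb] /andP[da db]; have := IHa va da; have := IHb vb db.
  set la := elength a; set lb := elength b => hb ha.
  rewrite abszM; apply: leq_trans (_ : 2 ^ (2 * maxn la lb) <= _)%N.
    rewrite mul2n -addnn expnD; apply: ltn_mul.
      exact: leq_trans ha (leq_pexp2l _ (leq_maxl _ _)).
    exact: leq_trans hb (leq_pexp2l _ (leq_maxr _ _)).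
  by rewrite leq_exp2l // leq_addr.
Qed.

(** Leaves of the refutation are represented by at most one bit, and this leaves room for it. *)
Lemma elength_scaled_gt0 V (e : expr V) : (0 < elength (scaled e))%N.
Proof.
elim: e => [v|c|a IHa b IHb|a IHa b IHb|a IHa b IHb] //=.
  by have [] := int_length_bound c.
by rewrite addn3.
Qed.

Lemma elength_multiplier_gt0 V (e : expr V) : (0 < elength (multiplier e))%N.
Proof.
by case: e => [v|c|a b|a b|a b] //=;
   rewrite ?addn3 //; have [] := int_length_bound 1.
Qed.

Lemma division_free_denominatorsW V (e : expr V) :
  division_free e -> division_free_denominators e.
Proof. by elim: e => //= a IHa b IHb /andP[/IHa-> /IHb->]. Qed.

Lemma mult_nat_gt0 V (e : expr V) :
  legal e -> division_free_denominators e -> (0 < mult_nat e)%N.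
Proof.
elim: e => //= [a IHa b IHb|a IHa b IHb|a IHa b IHb].
- by case/andP=> la lb /andP[da db]; rewrite muln_gt0 IHa ?IHb.
- by case/andP=> la lb /andP[da db]; rewrite muln_gt0 IHa ?IHb.
- case/and4P=> la lb vb nz /andP[da db]; rewrite muln_gt0 IHa //=.
  rewrite lt0n absz_eq0; apply: contra nz => /eqP b0.
  by rewrite eeval_ival // b0.
Qed.

End Multipliers.

(** * The circuit C(x, F) *)

Section Substitution.
Variables (n m : nat) (F : 'I_m -> circuit 'I_n).
Hypothesis wfF : forall j, well_formed (F j).
Local Notation var := (cps_var n m).

Fixpoint esubst (e : expr var) : expr 'I_n :=
  match e with
  | EVar (CpsX i) => EVar i
  | EVar (CpsY a) => unfold (ineq_circuit F a)
  | EConst c => EConst c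
  | EAdd a b => EAdd (esubst a) (esubst b)
  | EMul a b => EMul (esubst a) (esubst b)
  | EDiv a b => EDiv (esubst a) (esubst b)
  end.

Lemma division_free_esubst e : division_free (esubst e) -> division_free e.
Proof. by elim: e => //= a IHa b IHb /andP[/IHa-> /IHb->]. Qed.

Lemma division_free_denominators_esubst e :
  division_free_denominators (esubst e) -> division_free_denominators e.
Proof.
elim: e => //= [a IHa b IHb|a IHa b IHb|a IHa b IHb] /andP[/IHa->].
- by move/IHb->.
- by move/IHb->.
- by move/division_free_esubst->.
Qed.

Lemma elength_esubst e : variable_free e -> elength (esubst e) = elength e.
Proof. by elim: e => //= a IHa b IHb /andP[/IHa-> /IHb->]. Qed.

(** Only an inequality can hold: a placeholder contributes the factor 1 to [mult_nat], while the
    multiplier after substitution also contains the denominators of the axiom circuit. *)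
Lemma mult_nat_bound e : legal e -> division_free_denominators (esubst e) ->
  (mult_nat e < 2 ^ elength (multiplier (esubst e)))%N.
Proof.
have lt_mul x y u v : (x < 2 ^ u -> y < 2 ^ v -> x * y < 2 ^ (2 * maxn u v + 3))%N.
  move=> hx hy; apply: leq_trans (_ : 2 ^ (2 * maxn u v) <= _)%N.
    rewrite mul2n -addnn expnD; apply: ltn_mul.
      exact: leq_trans hx (leq_pexp2l _ (leq_maxl _ _)).
    exact: leq_trans hy (leq_pexp2l _ (leq_maxr _ _)).
  by rewrite leq_exp2l // leq_addr.
elim: e => [v _ _|c _ _|a IHa b IHb|a IHa b IHb|a IHa b _] /=.
- by rewrite -[1%N]/(2 ^ 0)%N ltn_exp2l // elength_multiplier_gt0.
- by have [] := int_length_bound 1.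
- by case/andP=> la lb /andP[da db]; apply: lt_mul; [apply: IHa | apply: IHb].
- by case/andP=> la lb /andP[da db]; apply: lt_mul; [apply: IHa | apply: IHb].
- case/and4P=> la lb vb _ /andP[da db]; apply: lt_mul; first exact: IHa.
  by rewrite elength_esubst //; apply: ival_bound => //; apply: division_free_esubst.
Qed.

Lemma exprs_shift V (ns ns' : seq (gate V)) :
  exprs (ns ++ [seq shift_gate (size ns) g | g <- ns']) = exprs ns ++ exprs ns'.
Proof.
elim/last_ind: ns' => [|ns' g IH]; first by rewrite !cats0.
rewrite map_rcons -rcons_cat !exprs_rcons IH -rcons_cat; congr rcons.
have nth_shift i : nth (EConst 0) (exprs ns ++ exprs ns') (size ns + i) =
    nth (EConst 0) (exprs ns') i.
  by rewrite nth_cat size_exprs ltnNge leq_addr addKn.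
by case: g => //= i j; rewrite !nth_shift.
Qed.

Lemma ineq_circuit_output a :
  (output (ineq_circuit F a) < csize (ineq_circuit F a))%N.
Proof.
case: a => // j; first by have /andP[] := wfF j.
by rewrite /csize /= size_cat /= addn2.
Qed.

Lemma lay_axioms ps : exists axs out,
  [/\ foldl (lay_axiom F) ([::], [::]) ps = (axs, out),
      size out = size ps, (size ps <= size axs)%N &
      forall a, a \in ps -> let p := nth 0%N out (index a ps) in
        (p < size axs)%N /\ expr_at axs p = unfold (ineq_circuit F a)].
Proof.
elim/last_ind: ps => [|ps a [axs [out [eqf sz le_sz loc]]]]; first by exists [::], [::].
rewrite foldl_rcons eqf /=; do 2!eexists; split; [by [] | by rewrite !size_rcons sz | |].
  have := ineq_circuit_output a; rewrite size_rcons size_cat size_map -/(csize _).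
  by move: le_sz; lia.
move=> b; rewrite mem_rcons inE -(cats1 ps) index_cat nth_rcons sz.
have [b_ps _ | nb_ps] := boolP (b \in ps).
  have [lt_p eq_p] := loc b b_ps; rewrite index_mem b_ps size_cat ltn_addr //; split=> //.
  by rewrite /expr_at exprs_shift nth_cat size_exprs lt_p.
rewrite orbF => /eqP->; rewrite /= eqxx addn0 ltnn eqxx; split.
  by rewrite size_cat size_map ltn_add2l ineq_circuit_output.
rewrite /expr_at exprs_shift nth_cat size_exprs ltnNge leq_addr addKn.
by [].
Qed.

Definition is_placeholder (g : gate var) := isSome (placeholder g).

Lemma lay_gates axs loc ns : topological ns ->
  (forall k a, (k < size ns)%N -> nth (Const 0) ns k = Var (CpsY a) ->
     (loc a < size axs)%N /\ expr_at axs (loc a) = unfold (ineq_circuit F a)) ->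
  exists code pos,
  [/\ foldl (lay_gate loc) (axs, [::]) ns = (code, pos), size pos = size ns,
      size code = (size axs + count (predC is_placeholder) ns)%N,
      (forall p, (p < size axs)%N -> expr_at code p = expr_at axs p) &
      forall k, (k < size ns)%N ->
        (nth 0%N pos k < size code)%N /\
        expr_at code (nth 0%N pos k) = esubst (expr_at ns k)].
Proof.
elim/last_ind: ns => [|ns g IH] top hloc.
  by exists axs, [::]; split; rewrite ?addn0.
have {top} [top topg] := (topological_rcons _ _).1 top.
have [|code [pos [eqf szp szc pre vals]]] := IH top.
  move=> k a lt_k eqg; apply: (hloc k); last by rewrite nth_rcons lt_k.
  by rewrite size_rcons ltnW.
have new h : all (fun i => i < size ns)%N (inputs g) ->
    predC is_placeholder g ->
    unfold_gate (exprs code) h = esubst (unfold_gate (exprs ns) g) ->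
  exists code' pos',
  [/\ (rcons code h, rcons pos (size code)) = (code', pos'),
      size pos' = size (rcons ns g),
      size code' = (size axs + count (predC is_placeholder) (rcons ns g))%N,
      (forall p, (p < size axs)%N -> expr_at code' p = expr_at axs p) &
      forall k, (k < size (rcons ns g))%N ->
        (nth 0%N pos' k < size code')%N /\
        expr_at code' (nth 0%N pos' k) = esubst (expr_at (rcons ns g) k)].
  move=> _ npg eqh; exists (rcons code h), (rcons pos (size code)); split=> //.
  - by rewrite !size_rcons szp.
  - by rewrite size_rcons szc -cats1 count_cat /=; move: npg => /= ->; rewrite addn1 addnS.
  - by move=> p lt_p; rewrite expr_at_rcons ?pre // szc ltn_addr.
  - move=> k; rewrite !size_rcons ltnS leq_eqVlt nth_rcons szp => /predU1P[->|lt_k].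
      by rewrite ltnn eqxx ltnSn !expr_at_last.
    have [lt_p eqe] := vals k lt_k.
    by rewrite lt_k !expr_at_rcons // ltnW.
have look i : (i < size ns)%N -> nth (EConst 0) (exprs code) (nth 0%N pos i) =
    esubst (nth (EConst 0) (exprs ns) i) by case/vals.
rewrite foldl_rcons eqf.
case: g topg hloc new => [[i|a]|c|i j|i j|i j] topg hloc new /=.
- exact: new.
- exists code, (rcons pos (loc a)); split=> //.
  + by rewrite !size_rcons szp.
  + by rewrite szc -cats1 count_cat /= !addn0.
  + have [] := hloc (size ns) a; rewrite ?size_rcons ?nth_rcons ?ltnn ?eqxx //.
    move=> lt_p eqe k; rewrite ltnS leq_eqVlt nth_rcons szp => /predU1P[->|lt_k].
      by rewrite ltnn eqxx expr_at_last pre // szc ltn_addr.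
    by rewrite lt_k expr_at_rcons //; apply: vals.
- exact: new.
- by case/and3P: (topg) => lt_i lt_j _; apply: new => //=; rewrite !look.
- by case/and3P: (topg) => lt_i lt_j _; apply: new => //=; rewrite !look.
- by case/and3P: (topg) => lt_i lt_j _; apply: new => //=; rewrite !look.
Qed.

Lemma mem_placeholders C k a : (k < csize C)%N ->
  nth (Const 0) (nodes C) k = Var (CpsY a) -> a \in @placeholders n m C.
Proof.
rewrite mem_undup /csize; elim: (nodes C) k => [|g ns IH] [|k] //=.
  by move=> _ ->; rewrite /= inE eqxx.
by move=> lt_k /(IH k lt_k) h; case: placeholder => //= b; rewrite inE h orbT.
Qed.

(** The second part carries the cost accounting. Leaves with the same placeholder share one copy of
    the axiom circuit, so the size of C(x, F) does not bound that of [C]; it bounds the number of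
    distinct placeholders plus that of the other nodes. *)
Lemma subst_axiomsP C : well_formed C ->
  unfold (subst_axioms F C) = esubst (unfold C) /\
  (size (placeholders C) + count (predC is_placeholder) (nodes C)
     <= csize (subst_axioms F C))%N.
Proof.
case/topologicalP=> lt_o top; rewrite /subst_axioms.
have [axs [out [-> sz le_sz loc]]] := lay_axioms (placeholders C).
have [|code [pos [-> szp szc _ vals]]] :=
  @lay_gates axs (fun a => nth 0%N out (index a (placeholders C))) _ top.
  by move=> k a lt_k /(mem_placeholders lt_k); apply: loc.
split; last by rewrite /csize /= szc leq_add2r.
by have [_] := vals _ lt_o.
Qed.

End Substitution.

(** * Binary representation of the nodes of a CPS refutation *)

Section Representation.
Variables (n m : nat) (F : 'I_m -> circuit 'I_n) (t : nat).
Local Notation A := {mpoly rat[n]}.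
Local Notation axiom j := (cpoly (F j)).

Definition ips_pair (v : ips_var n m) : A * A :=
  (ips_at_zero v, ips_at_axioms (fun j => axiom j) v).

Local Notation slp := (slp true ips_pair).
Local Notation grow := (grow true ips_pair).

(* The values of the variables of [C] at zero and at the axioms, when the
   placeholders are expressed by the IPS variables. *)
Definition cps_pair (v : cps_var n m) : A * A :=
  match v with
  | CpsX i => diag 'X_i
  | CpsY (EqGe j) => dev (axiom j)
  | CpsY (EqLe j) => dev (- axiom j)
  | CpsY (BoolGe i) => dev ('X_i ^+ 2 - 'X_i)
  | CpsY (BoolLe i) => dev (- ('X_i ^+ 2 - 'X_i))
  | CpsY (VarGe0 i) => diag 'X_i
  | CpsY (VarLe1 i) => diag (1 - 'X_i)
  end.

Lemma cpoly_neg (D : circuit 'I_n) : well_formed D ->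
  cpoly (neg_circuit D) = - cpoly D.
Proof.
case/andP=> lt_o _; rewrite /cpoly /ceval /unfold /unfold_at /= -!/(exprs _).
rewrite -cat_rcons cats1 -!/(expr_at _ _).
have -> : (csize D).+1 = size (rcons (nodes D) (Const (-1))) by rewrite size_rcons.
rewrite expr_at_last /= -!/(expr_at _ _) expr_at_last expr_at_rcons //=.
by rewrite mulrN1z mulN1r.
Qed.

Lemma cps_pair2 v : (forall j, constant_free (F j)) ->
  (cps_pair v).2 = cps_at_axioms F v.
Proof.
move=> cfF.
have wf_bool i : well_formed (@bool_circuit n i) by [].
have bool_poly i : cpoly (@bool_circuit n i) = 'X_i ^+ 2 - 'X_i.
  by rewrite /cpoly /ceval /= mulrN1z mulN1r.
case: v => [i|[j|j|i|i|i|i]] //=.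
- by rewrite cpoly_neg //; case/and3P: (cfF j).
- by rewrite cpoly_neg // bool_poly.
- by rewrite /cpoly /ceval /= mulrN1z mulr1z mulN1r.
Qed.

(** Only x_i >= 0 and 1 - x_i >= 0 do not vanish in the first coordinate, and their values are
    single bits. *)
Definition placeholder_ready (l : seq (bool * (A * A))) (a : ineq n m) :=
  knows l (cps_pair (CpsY a)) /\
  match a with
  | VarGe0 i => isbit l ('X_i : A)
  | VarLe1 i => isbit l (1 - 'X_i : A)
  | _ => True
  end.

Lemma placeholder_ready_sub l l' a : {subset l <= l'} ->
  placeholder_ready l a -> placeholder_ready l' a.
Proof.
move=> sub [k ka]; split; first exact: knows_sub k.
by case: a ka {k} => // i; apply: isbit_sub.
Qed.

Lemma grow_var l v : slp l -> grow l 1 (fun l' => knows l' (ips_pair v)).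
Proof.
move=> sl; apply: (grow_rcons (slp_var v sl)).
by apply/knowsP; exists false; rewrite mem_rcons mem_head.
Qed.

Lemma grow_xbit l i : slp l -> grow l 2 (fun l' => isbit l' ('X_i : A)).
Proof.
move=> sl; apply: (grow_bind (grow_var (IpsX m i) sl) (k2 := 1)) => //.
move=> l1 s1 sub1 k1; apply: grow_weaken (grow_var (IpsZ m i) s1) _ _ => //.
by move=> l2 s2 sub2 k2; split; first exact: knows_sub k1.
Qed.

Lemma grow_placeholder l a : slp l ->
  grow l 10 (fun l' => placeholder_ready l' a).
Proof.
move=> sl; case: a => [j|j|i|i|i|i].
- exact: grow_weaken (grow_var (IpsY n j) sl) _ _.
- apply: (grow_bind (grow_var (IpsY n j) sl) (k2 := 2)) => // l1 s1 _ k.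
  apply: grow_weaken (grow_neg s1 k) _ _ => // l2 _ _ k2; split=> //.
  by rewrite /= /dev -[0]oppr0.
- exact: grow_weaken (grow_var (IpsZ m i) sl) _ _.
- apply: (grow_bind (grow_var (IpsZ m i) sl) (k2 := 2)) => // l1 s1 _ k.
  apply: grow_weaken (grow_neg s1 k) _ _ => // l2 _ _ k2; split=> //.
  by rewrite /= /dev -[0]oppr0.
- apply: grow_weaken (grow_xbit i sl) _ _ => // l' _ _ b; split=> //.
  by case: b.
- apply: (grow_bind (grow_xbit i sl) (k2 := 4)) => // l1 s1 _ b.
  apply: grow_weaken (bit_not s1 b) _ _ => // l2 _ _ b2; split=> //.
  by case: b2.
Qed.

Lemma grow_placeholders l ps : slp l ->
  grow l (10 * size ps) (fun l' => {in ps, forall a, placeholder_ready l' a}).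
Proof.
elim: ps l => [|a ps IH] l sl; first exact: grow_refl.
apply: (grow_bind (grow_placeholder a sl) (k2 := 10 * size ps)%N).
  by rewrite /= mulnS.
move=> l1 s1 sub1 ra; apply: grow_weaken (IH _ s1) _ _ => // l2 s2 sub2 h b.
by rewrite inE => /predU1P[-> | /h //]; apply: placeholder_ready_sub ra.
Qed.

Implicit Types (l : seq (bool * (A * A))) (a b e : expr (cps_var n m)).

Local Notation val e := (eeval cps_pair e).
Local Notation len e := (elength (scaled (esubst F e))).
Local Notation mlen e := (elength (multiplier (esubst F e))).
Local Notation mult e := ((mult_nat e)%:R : A).
Local Notation dfd e := (division_free_denominators (esubst F e)).

Definition signed_rep l e := exists p q : seq A,
  [/\ (size p <= len e)%N /\ (size q <= len e)%N, bits l p, bits l q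
    & mult e * (val e).1 = val2 p - val2 q].

(** The second coordinate is the relevant one, since there the output is the constant -1; agreement
    with a single nonnegative number holds only modulo the axioms and is therefore a derivation. *)
Definition unsigned_rep l e := exists p : seq A,
  [/\ (size p <= len e)%N, bits l p
    & knows l (dev (mult e * (val e).2 - val2 p))].

Lemma signed_rep_sub l l' e : {subset l <= l'} -> signed_rep l e -> signed_rep l' e.
Proof.
move=> sub [p [q [sz hp hq eqv]]].
by exists p, q; split=> //; apply: bits_sub; eassumption.
Qed.

Lemma unsigned_rep_sub l l' e :
  {subset l <= l'} -> unsigned_rep l e -> unsigned_rep l' e.
Proof.
move=> sub [p [sz hp k]].
by exists p; split=> //; [apply: bits_sub hp | apply: knows_sub k].
Qed.

(** Multipliers are written in binary only at additions, where the syntactic length accounts for the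
    products M_b (M_a a) and M_a (M_b b). At product and division gates a multiplier may have more
    than [t] bits and is kept only as a ring value. *)
Lemma scaled_products l a b p1 p2 : slp l -> has_bits01 l ->
  legal a -> legal b -> dfd a -> dfd b -> (len (EAdd a b) <= t)%N ->
  bits l p1 -> bits l p2 -> (size p1 <= len a)%N -> (size p2 <= len b)%N ->
  grow l (420 * t ^ 2 + 200 * t) (fun l' => exists p : seq A,
    [/\ (size p <= len (EAdd a b))%N, bits l' p
      & val2 p = mult b * val2 p1 + mult a * val2 p2]).
Proof.
move=> sl h01 la lb da db le_t hp1 hp2 sz1 sz2.
have [ma [szma hma vma]] := bits_nat h01 (mult_nat_bound la da).
have [mb [szmb hmb vmb]] := bits_nat h01 (mult_nat_bound lb db).
move: le_t => /=; set w := maxn _ _ => le_t.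
have [wb wa] : (mlen b + len a <= w)%N /\ (mlen a + len b <= w)%N.
  by rewrite /w; split; lia.
have prod (x y : nat) : (x + y <= w -> 210 * (x * y) <= 210 * t ^ 2)%N.
  by move=> le_w; rewrite leq_mul2l /= leq_mul //; lia.
have g1 := bits_mul sl h01 hmb hp1 (eq_leq szmb) sz1.
apply: (grow_bind g1 (k2 := 210 * t ^ 2 + 200 * t)%N).
  by have := prod _ _ wb; lia.
move=> l1 s1 sub1 [q1 [szq1 hq1 vq1]].
have g2 := bits_mul s1 (has_bits01_sub sub1 h01) (bits_sub sub1 hma)
  (bits_sub sub1 hp2) (eq_leq szma) sz2.
apply: (grow_bind g2 (k2 := 200 * t)%N); first by have := prod _ _ wa; lia.
move=> l2 s2 sub2 [q2 [szq2 hq2 vq2]].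
have g3 := bits_add s2 (has_bits01_sub sub2 (has_bits01_sub sub1 h01))
  (bits_sub sub2 hq1) hq2 (leq_trans szq1 wb) (leq_trans szq2 wa).
apply: grow_weaken g3 _ _ => [|l3 _ _ [s [szs hs vs]]].
  by rewrite leq_mul2l; apply/orP; right; lia.
by exists s; rewrite szs vs vq1 vq2 vma vmb.
Qed.

Lemma signed_rep_add l a b : slp l -> has_bits01 l ->
  legal a -> legal b -> dfd a -> dfd b -> (len (EAdd a b) <= t)%N ->
  signed_rep l a -> signed_rep l b ->
  grow l (840 * t ^ 2 + 400 * t) (fun l' => signed_rep l' (EAdd a b)).
Proof.
move=> sl h01 la lb da db le_t [p1 [q1 [[szp1 szq1] hp1 hq1 e1]]]
  [p2 [q2 [[szp2 szq2] hp2 hq2 e2]]].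
have g1 := scaled_products sl h01 la lb da db le_t hp1 hp2 szp1 szp2.
apply: (grow_bind g1 (k2 := 420 * t ^ 2 + 200 * t)%N); first by lia.
move=> l1 s1 sub1 [p [szp hp vp]].
have g2 := scaled_products s1 (has_bits01_sub sub1 h01) la lb da db le_t
  (bits_sub sub1 hq1) (bits_sub sub1 hq2) szq1 szq2.
apply: grow_weaken g2 _ _ => // l2 s2 sub2 [q [szq hq vq]].
exists p, q; split=> //; first exact: bits_sub hp.
rewrite vp vq [mult_nat _]/= natrM [eeval _ _]/= fst_add.
have -> : val2 p1 = mult a * (val a).1 + val2 q1 by rewrite e1 subrK.
have -> : val2 p2 = mult b * (val b).1 + val2 q2 by rewrite e2 subrK.
by ring.
Qed.

Lemma unsigned_rep_add l a b : slp l -> has_bits01 l ->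
  legal a -> legal b -> dfd a -> dfd b -> (len (EAdd a b) <= t)%N ->
  knows l (diag (mult a)) -> knows l (diag (mult b)) ->
  unsigned_rep l a -> unsigned_rep l b ->
  grow l (420 * t ^ 2 + 200 * t + 3) (fun l' => unsigned_rep l' (EAdd a b)).
Proof.
move=> sl h01 la lb da db le_t kma kmb [p1 [szp1 hp1 k1]] [p2 [szp2 hp2 k2]].
have g1 := scaled_products sl h01 la lb da db le_t hp1 hp2 szp1 szp2.
apply: (grow_bind g1 (leqnn _)) => l1 s1 sub1 [p [szp hp vp]].
have [{}kma {}kmb] := (knows_sub sub1 kma, knows_sub sub1 kmb).
have [{}k1 {}k2] := (knows_sub sub1 k1, knows_sub sub1 k2).
suff g : grow l1 3 (fun l' => knows l'
    (dev (mult (EAdd a b) * (val (EAdd a b)).2 - val2 p))).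
  apply: grow_weaken g _ _ => // l2 s2 sub2 k.
  by exists p; split=> //; apply: bits_sub hp.
apply: (@grow_formula _ _ _ _ _
  (EAdd (EMul (EVar (diag (mult b))) (EVar (dev (mult a * (val a).2 - val2 p1))))
        (EMul (EVar (diag (mult a))) (EVar (dev (mult b * (val b).2 - val2 p2)))))) => //.
rewrite /dev /diag [eeval id _]/= vp [mult_nat _]/= natrM [eeval cps_pair (EAdd _ _)]/=.
by apply: pair_ext; rewrite !pairE /=; ring.
Qed.

(** (p1 - q1)(p2 - q2) = (p1 p2 + q1 q2) - (p1 q2 + q1 p2). Each sum takes [len a + len b + 1] bits,
    within the length of a product. *)
Lemma signed_rep_mul l a b : slp l -> has_bits01 l ->
  (len (EMul a b) <= t)%N ->
  signed_rep l a -> signed_rep l b ->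
  grow l (840 * t ^ 2 + 400 * t) (fun l' => signed_rep l' (EMul a b)).
Proof.
move=> sl h01 /= le_t [p1 [q1 [[szp1 szq1] hp1 hq1 e1]]]
  [p2 [q2 [[szp2 szq2] hp2 hq2 e2]]].
have le_prod : (210 * (len a * len b) <= 210 * t ^ 2)%N.
  by rewrite leq_mul2l /= leq_mul //; lia.
have le_sum : (len a + len b <= t)%N by lia.
have g1 := bits_mul sl h01 hp1 hp2 szp1 szp2.
apply: (grow_bind g1 (k2 := 630 * t ^ 2 + 400 * t)%N); first by lia.
move=> l1 s1 sub1 [r1 [sz1 hr1 v1]]; have h1 := has_bits01_sub sub1 h01.
have g2 := bits_mul s1 h1 (bits_sub sub1 hq1) (bits_sub sub1 hq2) szq1 szq2.
apply: (grow_bind g2 (k2 := 420 * t ^ 2 + 400 * t)%N); first by lia.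
move=> l2 s2 sub2 [r2 [sz2 hr2 v2]].
have sub12 := fun x hx => sub2 x (sub1 x hx).
have h2 := has_bits01_sub sub12 h01.
have g3 := bits_mul s2 h2 (bits_sub sub12 hp1) (bits_sub sub12 hq2) szp1 szq2.
apply: (grow_bind g3 (k2 := 210 * t ^ 2 + 400 * t)%N); first by lia.
move=> l3 s3 sub3 [r3 [sz3 hr3 v3]].
have sub13 := fun x hx => sub3 x (sub12 x hx).
have h3 := has_bits01_sub sub13 h01.
have g4 := bits_mul s3 h3 (bits_sub sub13 hq1) (bits_sub sub13 hp2) szq1 szp2.
apply: (grow_bind g4 (k2 := 400 * t)%N); first by lia.
move=> l4 s4 sub4 [r4 [sz4 hr4 v4]]; have h4 := has_bits01_sub sub4 h3.
have sub24 := fun x hx => sub4 x (sub3 x hx).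
have g5 := bits_add s4 h4 (bits_sub sub24 (bits_sub sub2 hr1))
  (bits_sub sub24 hr2) sz1 sz2.
apply: (grow_bind g5 (k2 := 200 * t)%N); first by lia.
move=> l5 s5 sub5 [p [szp hp vp]]; have h5 := has_bits01_sub sub5 h4.
have g6 := bits_add s5 h5 (bits_sub sub5 (bits_sub sub4 hr3))
  (bits_sub sub5 hr4) sz3 sz4.
apply: grow_weaken g6 _ _ => [|l6 s6 sub6 [q [szq hq vq]]]; first by lia.
exists p, q; split=> //; first by rewrite szp szq /=; split; lia.
  exact: bits_sub hp.
rewrite vp vq v1 v2 v3 v4 [mult_nat _]/= natrM [eeval _ _]/= fst_mul.
have -> : val2 p1 = mult a * (val a).1 + val2 q1 by rewrite e1 subrK.
have -> : val2 p2 = mult b * (val b).1 + val2 q2 by rewrite e2 subrK.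
by ring.
Qed.

Lemma unsigned_rep_mul l a b : slp l -> has_bits01 l ->
  (len (EMul a b) <= t)%N ->
  knows l (diag (mult a)) -> knows l (val a) ->
  unsigned_rep l a -> unsigned_rep l b ->
  grow l (210 * t ^ 2 + 4 * t + 4) (fun l' => unsigned_rep l' (EMul a b)).
Proof.
move=> sl h01 /= le_t kma kva [p1 [szp1 hp1 k1]] [p2 [szp2 hp2 k2]].
have le_prod : (210 * (len a * len b) <= 210 * t ^ 2)%N.
  by rewrite leq_mul2l /= leq_mul //; lia.
apply: (grow_bind (bits_mul sl h01 hp1 hp2 szp1 szp2) (k2 := 4 * t + 4)%N).
  by lia.
move=> l1 s1 sub1 [p [szp hp vp]].
apply: (grow_bind (bits_val s1 (has_bits01_sub sub1 h01) (bits_sub sub1 hp2)) (k2 := 4)).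
  by rewrite leq_add2r leq_mul2l /= (leq_trans szp2) //; lia.
move=> l2 s2 sub2 kp2; have sub12 := fun x hx => sub2 x (sub1 x hx).
have [{}kma {}kva] := (knows_sub sub12 kma, knows_sub sub12 kva).
have [{}k1 {}k2] := (knows_sub sub12 k1, knows_sub sub12 k2).
suff g : grow l2 4 (fun l' => knows l'
    (dev (mult (EMul a b) * (val (EMul a b)).2 - val2 p))).
  apply: grow_weaken g _ _ => // l3 s3 sub3 k.
  exists p; split=> //=; first by apply: leq_trans szp _; lia.
  exact: bits_sub (fun x hx => sub3 x (sub2 x hx)) hp.
apply: (@grow_formula _ _ _ _ _
  (EAdd (EMul (EMul (EVar (diag (mult a))) (EVar (val a)))
              (EVar (dev (mult b * (val b).2 - val2 p2))))
        (EMul (EVar (diag (val2 p2)))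
              (EVar (dev (mult a * (val a).2 - val2 p1)))))) => //.
rewrite /dev /diag [eeval id _]/= vp [mult_nat _]/= natrM [eeval cps_pair (EMul _ _)]/=.
by apply: pair_ext; rewrite !pairE /=; ring.
Qed.

(** The first coordinate of u = M_a a is exactly p - q. Hence u^2 - v^2 with v = [diag] of p - q is
    a derivation of M_a^2 a^2 - (p - q)^2, and [bits_abs] replaces (p - q)^2 by the square of one
    nonnegative number. *)
Lemma unsigned_rep_sqr l a : slp l -> has_bits01 l ->
  (len (EMul a a) <= t)%N ->
  knows l (diag (mult a)) -> knows l (val a) ->
  signed_rep l a ->
  grow l (210 * t ^ 2 + 1008 * t + 120) (fun l' => unsigned_rep l' (EMul a a)).
Proof.
move=> sl h01 /= le_t kma kva [p [q [[szp szq] hp hq eqv]]].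
have le_prod : (210 * ((len a).+1 * (len a).+1) <= 210 * t ^ 2)%N.
  by rewrite leq_mul2l /= leq_mul //; lia.
apply: (grow_bind (bits_abs sl h01 hp hq szp szq) (k2 := 210 * t ^ 2 + 8 * t + 20)%N).
  by lia.
move=> l1 s1 sub1 [s [szs hs ks]]; have h1 := has_bits01_sub sub1 h01.
apply: (grow_bind (bits_mul s1 h1 hs hs szs szs) (k2 := 8 * t + 20)%N).
  by lia.
move=> l2 s2 sub2 [r [szr hr vr]]; have h2 := has_bits01_sub sub2 h1.
have sub12 := fun x hx => sub2 x (sub1 x hx).
apply: (grow_bind (bits_val s2 h2 (bits_sub sub12 hp)) (k2 := 4 * t + 20)%N).
  have : (size p <= t)%N by rewrite (leq_trans szp) //; lia.
  by move: (size p) => sp; lia.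
move=> l3 s3 sub3 kp; have sub13 := fun x hx => sub3 x (sub12 x hx).
apply: (grow_bind (bits_val s3 (has_bits01_sub sub3 h2) (bits_sub sub13 hq)) (k2 := 20)%N).
  have : (size q <= t)%N by rewrite (leq_trans szq) //; lia.
  by move: (size q) => sq; lia.
move=> l4 s4 sub4 kq; have sub14 := fun x hx => sub4 x (sub13 x hx).
have [{}kma {}kva] := (knows_sub sub14 kma, knows_sub sub14 kva).
have {}ks := knows_sub (fun x hx => sub4 x (sub3 x (sub2 x hx))) ks.
have {}kp := knows_sub sub4 kp.
suff g : grow l4 20 (fun l' => knows l'
    (dev (mult (EMul a a) * (val (EMul a a)).2 - val2 r))).
  apply: grow_weaken g _ _ => // l5 s5 sub5 k.
  (* The absolute value has [len a + 1] bits, its square [2 * len a + 2], one less than the length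
     of the product gate. *)
  exists r; split=> //=; first by apply: leq_trans szr _; lia.
  exact: bits_sub (fun x hx => sub5 x (sub4 x (sub3 x hx))) hr.
pose u := EMul (EVar (diag (mult a))) (EVar (val a)).
pose v := EAdd (EVar (diag (val2 p))) (EMul (EConst (-1)) (EVar (diag (val2 q)))).
apply: (@grow_formula _ _ _ _ _
  (EAdd (EAdd (EMul u u) (EMul (EConst (-1)) (EMul v v)))
    (EVar (dev ((val2 p - val2 q) ^+ 2 - val2 s ^+ 2))))) => //.
rewrite /dev /diag [eeval id _]/= vr [mult_nat _]/= natrM [eeval cps_pair (EMul _ _)]/=.
rewrite mulrN1z; have -> : val2 p = mult a * (val a).1 + val2 q by rewrite eqv subrK.
by apply: pair_ext; rewrite !pairE /=; ring.
Qed.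

End Representation.

(** * Gate-by-gate simulation of the CPS refutation *)

Section Simulation.
Variables (n m : nat) (F : 'I_m -> circuit 'I_n) (C : circuit (cps_var n m)).
Variable t : nat.
Local Notation A := {mpoly rat[n]}.
Local Notation slp := (slp true (ips_pair F)).
Local Notation grow := (grow true (ips_pair F)).
Local Notation val e := (eeval (cps_pair F) e).
Local Notation len e := (elength (scaled (esubst F e))).
Local Notation mult e := ((mult_nat e)%:R : A).
Local Notation dfd e := (division_free_denominators (esubst F e)).
Local Notation node k := (expr_at (nodes C) k).
Implicit Types (l : seq (bool * (A * A))) (a b e : expr (cps_var n m)).

Definition rat_pair : {rmorphism rat -> (A * A)%type} := GRing.in_alg (A * A)%type.

(** Conicity localized at a node, so that it can be passed down; at the output it is [conic C] by
    conversion. *)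
Definition conic_at k := forall k0 p,
  must_be_squared (gate_at C k0) -> path (wire C) k0 p -> last k0 p = k ->
  has (squaring C) (k0 :: p).

(** A path ending at [i] extends to [k]; as [k] is not a squaring gate, the squaring gate lies on
    the part up to [i]. *)
Lemma conic_at_input k i : conic_at k -> i \in inputs (gate_at C k) ->
  squaring C k = false -> conic_at i.
Proof.
move=> ck ik nsq k0 p mbs pth lst.
have := ck k0 (rcons p k) mbs; rewrite rcons_path pth lst last_rcons /=.
rewrite {1}/wire ik has_rcons nsq => /(_ isT erefl).
by [].
Qed.

(** Negative constants enter only under squares. Applied to denominators, this excludes a division
    that would turn a nonnegative value at a conic node into a negative one. *)
Lemma ival_conic k : constant_free C -> (k < csize C)%N -> conic_at k ->
  variable_free (node k) -> division_free (node k) -> 0 <= ival (node k).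
Proof.
move=> cfC; have [/topologicalP[_ top] sm _] := and3P cfC.
elim/ltn_ind: k => k IH lt_k ck; have := top _ lt_k; rewrite expr_atE //.
have inp i := @conic_at_input k i ck.
move: inp; have := ck k [::]; rewrite /squaring /gate_at /=.
case: (nth _ _ k) => [v|c|i j|i j|i j] //= ck0 inp.
- by move=> _ _ _; rewrite leNgt; apply/negP => /ck0/(_ isT erefl).
- case/and3P=> lt_i lt_j _ /andP[vi vj] /andP[di dj].
  by rewrite addr_ge0 // IH ?(ltn_trans _ lt_k) //; apply: inp; rewrite ?inE ?eqxx ?orbT.
- case/and3P=> lt_i lt_j _ /andP[vi vj] /andP[di dj].
  have [eij | nij] := eqVneq i j; first by rewrite eij -expr2 sqr_ge0.
  move/negbTE: nij inp => -> inp.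
  by rewrite mulr_ge0 // IH ?(ltn_trans _ lt_k) //; apply: inp; rewrite ?inE ?eqxx ?orbT.
Qed.

Lemma val_denominator b : legal b -> variable_free b -> dfd b ->
  division_free (esubst F b) ->
  val b = diag ((ival b)%:~R : A).
Proof.
move=> lb vb _ db; rewrite eeval_ival //; last exact: division_free_esubst db.
by apply: pair_ext; rewrite ?(rmorph_int fst) ?(rmorph_int snd).
Qed.

Lemma division_value a b : legal (EDiv a b) -> dfd (EDiv a b) ->
  val (EDiv a b) * diag ((ival b)%:~R : A) = val a.
Proof.
case/and4P=> la lb vb nz /= /andP[da db].
rewrite -val_denominator //; last exact: division_free_denominatorsW.
by rewrite divrK // (eeval_variable_free rat_pair) // rmorph_unit // unitfE.
Qed.

(** No new bits: M_a |b| times a / b is M_a a up to sign, and a negative b exchanges the two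
    numbers. *)
Lemma signed_rep_div l a b : legal (EDiv a b) -> dfd (EDiv a b) ->
  signed_rep F l a -> signed_rep F l (EDiv a b).
Proof.
move=> lg df [p [q [[szp szq] hp hq]]]; rewrite -(division_value lg df) => e.
have [b0 | b0] := leP 0 (ival b).
  exists p, q; split=> //; rewrite -e [mult_nat _]/= natrM fst_mul /=.
  have -> : ((ival b)%:~R : A) = (`|ival b|%N)%:R by rewrite pmulrn (gez0_abs b0).
  by ring.
exists q, p; split=> //; rewrite -[RHS]opprB -e [mult_nat _]/= natrM fst_mul /=.
have -> : ((ival b)%:~R : A) = - (`|ival b|%N)%:R.
  by rewrite pmulrn -rmorphN /= (ltz0_abs b0) opprK.
by ring.
Qed.

Lemma unsigned_rep_div l a b : legal (EDiv a b) -> dfd (EDiv a b) ->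
  0 <= ival b -> unsigned_rep F l a -> unsigned_rep F l (EDiv a b).
Proof.
move=> lg df b0 [p [szp hp]]; rewrite -(division_value lg df) => k.
exists p; split=> //; congr (knows _ (dev _)): k; rewrite [mult_nat _]/= snd_mul /=.
have -> : ((ival b)%:~R : A) = (`|ival b|%N)%:R by rewrite pmulrn (gez0_abs b0).
by rewrite natrM; ring.
Qed.

Lemma knows_mult_div l a b : slp l -> legal (EDiv a b) -> dfd (EDiv a b) ->
  knows l (diag (mult a)) -> knows l (val b) ->
  grow l 3 (fun l' => knows l' (diag (mult (EDiv a b)))).
Proof.
move=> sl lg df kma kb; have /and4P[la lb vb nz] := lg.
have /= /andP[da db] := df.
have g : grow l 2 (fun l' => knows l' (diag ((`|ival b|%N)%:R : A))).
  rewrite val_denominator // in kb; last exact: division_free_denominatorsW.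
  have [b0 | b0] := leP 0 (ival b).
    by apply: grow_refl => //; rewrite pmulrn (gez0_abs b0).
  apply: grow_weaken (grow_neg sl kb) _ _ => // l' _ _.
  by congr (knows _ _); rewrite pmulrn (ltz0_abs b0) rmorphN.
apply: (grow_bind g (k2 := 1)) => // l1 s1 sub1 kb1.
apply: grow_weaken (knows_mul s1 (knows_sub sub1 kma) kb1) _ _ => // l2 _ _.
by rewrite /= natrM.
Qed.

(** The bound is given at the output and descends to the inputs of sums and products and to
    numerators. Nodes not reached this way may be arbitrarily long, so every claim about bits is
    conditional on it. *)
Definition bounded e := dfd e && (len e <= t)%N.

(* [cn] tells whether the node with expression [e] is a conic one. *)
Definition processed l e (cn : Prop) :=
  [/\ sim (cps_pair F) l e,
      bounded e -> knows l (diag (mult e)) /\ signed_rep F l e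
    & bounded e -> cn -> unsigned_rep F l e].

Lemma processed_sub l l' e cn : {subset l <= l'} ->
  processed l e cn -> processed l' e cn.
Proof.
move=> sub [s g c]; split; first exact: sim_sub s.
  by move=> /g[km sr]; split; [apply: knows_sub km | apply: signed_rep_sub sr].
by move=> bd ck; apply: unsigned_rep_sub (c bd ck).
Qed.

Lemma grow_processed l e (cn : Prop) k1 k2 k3 k4 :
  grow l k1 (fun l' => sim (cps_pair F) l' e) ->
  (forall l', slp l' -> {subset l <= l'} -> bounded e ->
     grow l' k2 (fun l2 => knows l2 (diag (mult e)))) ->
  (forall l', slp l' -> {subset l <= l'} -> bounded e ->
     grow l' k3 (fun l2 => signed_rep F l2 e)) ->
  (forall l', slp l' -> {subset l <= l'} -> bounded e -> cn ->
     grow l' k4 (fun l2 => unsigned_rep F l2 e)) ->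
  grow l (k1 + (k2 + (k3 + k4))) (fun l' => processed l' e cn).
Proof.
move=> g1 g2 g3 g4; apply: (grow_bind g1 (leqnn _)) => l1 s1 sub1 h1.
have [bd | nbd] := boolP (bounded e); last first.
  by apply: grow_refl => //; split=> // bd; rewrite bd in nbd.
apply: (grow_bind (g2 _ s1 sub1 bd) (leqnn _)) => l2 s2 sub2 h2.
have sub02 := fun x hx => sub2 x (sub1 x hx).
apply: (grow_bind (g3 _ s2 sub02 bd) (leqnn _)) => l3 s3 sub3 h3.
have sub03 := fun x hx => sub3 x (sub02 x hx).
(* Conicity quantifies over all paths, so the case distinction is classical; the budget [k4] is
   reserved in both cases. *)
have [ck | nck] := classic cn.
  apply: grow_weaken (g4 _ s3 sub03 bd ck) _ _ => // l4 s4 sub4 h4; split=> [|_|//].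
    exact: sim_sub (fun x hx => sub4 x (sub3 x (sub2 x hx))) h1.
  split; last exact: signed_rep_sub h3.
  exact: knows_sub (fun x hx => sub4 x (sub3 x hx)) h2.
apply: grow_refl => //; split=> //.
  exact: sim_sub (fun x hx => sub3 x (sub2 x hx)) h1.
by split=> //; apply: knows_sub h2.
Qed.

(** The worst cases are [840 * t ^ 2 + 400 * t] for a signed sum or product, [420 * t ^ 2] for an
    unsigned sum, and a linear term for the absolute value at a squaring; they add up to at most
    [1260 * t ^ 2 + 1500 * t + 124]. *)
Definition gate_cost := (2000 * t.+1 ^ 2)%N.

Lemma gate_costP k2 k3 k4 : (k2 <= 3)%N -> (k3 <= 840 * t ^ 2 + 400 * t)%N ->
  (k4 <= 420 * t ^ 2 + 1100 * t + 120)%N ->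
  (1 + (k2 + (k3 + k4)) <= gate_cost)%N.
Proof. by rewrite /gate_cost; nia. Qed.

(** That no nodes are added is essential: the number of placeholder leaves of [C] is not controlled
    by the size of C(x, F). *)
Lemma processed_placeholder l (a : ineq n m) cn : has_bits01 l -> slp l ->
  placeholder_ready F l a -> processed l (EVar (CpsY a)) cn.
Proof.
move=> [h0 h1] sl [kv ka]; have [f fl] := knowsP _ _ kv.
have len0 := elength_scaled_gt0 (esubst F (EVar (CpsY a))).
split.
- by exists f.
- move=> _; split; first by case: h1.
  case: a {kv fl} ka len0 => [j|j|i|i|i|i] ka len0;
    try by exists [::], [::]; split=> //=; rewrite mulr0 subr0.
  + exists [:: 'X_i], [::]; split=> //=; first exact/bits_cons.
    by rewrite mulr0 addr0 subr0 mul1r.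
  + exists [:: 1 - 'X_i], [::]; split=> //=; first exact/bits_cons.
    by rewrite mulr0 addr0 subr0 mul1r.
- have kv0 : forall x : A, knows l (dev (1 * x - x)).
    by move=> x; rewrite mul1r subrr; case: h0.
  move=> _ _; case: a {fl} kv ka len0 => [j|j|i|i|i|i] kv ka len0;
    try by exists [::]; split=> //=; rewrite mul1r subr0.
  + exists [:: 'X_i]; split=> //=; first exact/bits_cons.
    by rewrite mulr0 addr0; apply: kv0.
  + exists [:: 1 - 'X_i]; split=> //=; first exact/bits_cons.
    by rewrite mulr0 addr0; apply: kv0.
Qed.

Lemma processed_var l i (cn : Prop) : slp l -> has_bits01 l -> ~ cn ->
  grow l gate_cost (fun l' => processed l' (EVar (CpsX m i)) cn).
Proof.
move=> sl [_ h1] ncn.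
apply: grow_weaken (grow_processed (e := EVar (CpsX m i)) (cn := cn)
    (k1 := 1) (k2 := 0) (k3 := 2) (k4 := 0) _ _ _ _)
    (leq_trans _ (gate_costP (leqnn _) (leqnn _) (leqnn _))) _
  => [|l' s' sub' _|l' s' sub' _|//||//].
- apply: (grow_rcons (slp_var (IpsX m i) sl)).
  by exists false; rewrite ?mem_rcons ?mem_head.
- by apply: grow_refl => //; case: (isbit_sub sub' h1).
- apply: grow_weaken (grow_xbit i s') _ _ => // l2 s2 sub2 hx.
  exists [:: 'X_i], [::]; split=> //=; first exact/bits_cons.
  by rewrite mulr0 addr0 subr0 mul1r.
- by lia.
Qed.

Lemma processed_const l c (cn : Prop) : slp l -> has_bits01 l ->
  c \in [:: 0; 1; -1] -> (c < 0 -> ~ cn) ->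
  grow l gate_cost (fun l' => processed l' (EConst c) cn).
Proof.
move=> sl [h0 h1] sc ncn.
have len0 := elength_scaled_gt0 (esubst F (EConst c)).
have b1 l' : {subset l <= l'} -> bits l' [:: 1 : A].
  by move=> sub; apply/bits_cons; split; first exact: isbit_sub h1.
apply: grow_weaken (grow_processed (e := EConst c) (cn := cn)
    (k1 := 1) (k2 := 0) (k3 := 0) (k4 := 0) _ _ _ _)
    (gate_costP _ _ _) _
  => [|l' s' sub' _|l' s' sub' _|l' s' sub' _ ck| | | |//] //.
- exact: sim_const.
- by apply: grow_refl => //; case: (isbit_sub sub' h1).
- apply: grow_refl => //; have {}b1 := b1 _ sub'.
  move: sc len0; rewrite !inE => /or3P[] /eqP-> /= len0.
  + by exists [::], [::]; split=> //=; rewrite mulr0 subr0.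
  + exists [:: 1], [::]; split=> //=.
    by rewrite mulr0 addr0 subr0 mul1r.
  + exists [::], [:: 1]; split=> //=.
    by rewrite mulr0 addr0 add0r mul1r.
- apply: grow_refl => //; have {}b1 := b1 _ sub'.
  have k0 : knows l' (dev (0 : A)) by case: (isbit_sub sub' h0).
  move: sc ncn len0; rewrite !inE => /or3P[] /eqP-> ncn /= len0.
  + by exists [::]; split=> //=; rewrite mulr0 subr0.
  + by exists [:: 1]; split=> //=; rewrite mulr0 addr0 mul1r subrr.
  + by have := ncn isT ck.
Qed.

Lemma processed_add l a b (ca cb cn : Prop) : slp l -> has_bits01 l ->
  legal (EAdd a b) -> processed l a ca -> processed l b cb ->
  (cn -> ca /\ cb) ->
  grow l gate_cost (fun l' => processed l' (EAdd a b) cn).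
Proof.
move=> sl h01 /= /andP[la lb] [sa ga ua] [sb gb ub] cab.
have bdd : bounded (EAdd a b) -> [/\ dfd a, dfd b, bounded a, bounded b
    & (len (EAdd a b) <= t)%N].
  rewrite /bounded /= => /andP[/andP[-> ->] le_t] /=.
  by split=> //; move: le_t; lia.
apply: grow_weaken (grow_processed (cn := cn) (sim_add sl sa sb)
    (k2 := 1) (k3 := 840 * t ^ 2 + 400 * t)
    (k4 := 420 * t ^ 2 + 200 * t + 3) _ _ _) (gate_costP _ _ _) _
  => [l' s' sub' bd|l' s' sub' bd|l' s' sub' bd ck| | | |//] //.
- have [_ _ /ga[ka _] /gb[kb _] _] := bdd bd.
  rewrite /= natrM.
  exact: knows_mul s' (knows_sub sub' ka) (knows_sub sub' kb).
- have [da db /ga[_ ra] /gb[_ rb] le_t] := bdd bd.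
  apply: (signed_rep_add s' (has_bits01_sub sub' h01) la lb da db le_t).
    exact: signed_rep_sub ra.
  exact: signed_rep_sub rb.
- have [da db ba bb le_t] := bdd bd; have [cca ccb] := cab ck.
  have [[ka _] [kb _]] := (ga ba, gb bb).
  apply: (unsigned_rep_add s' (has_bits01_sub sub' h01) la lb da db le_t).
  + exact: knows_sub ka.
  + exact: knows_sub kb.
  + exact: unsigned_rep_sub (ua ba cca).
  + exact: unsigned_rep_sub (ub bb ccb).
- by lia.
Qed.

Lemma processed_mul l a b (ca cb cn : Prop) : slp l -> has_bits01 l ->
  legal (EMul a b) -> processed l a ca -> processed l b cb ->
  (cn -> a = b \/ ca /\ cb) ->
  grow l gate_cost (fun l' => processed l' (EMul a b) cn).
Proof.
move=> sl h01 /= /andP[la lb] [sa ga ua] [sb gb ub] cab.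
have bdd : bounded (EMul a b) -> [/\ bounded a, bounded b
    & (len (EMul a b) <= t)%N].
  rewrite /bounded /= => /andP[/andP[-> ->] le_t] /=.
  by split=> //; move: le_t; lia.
apply: grow_weaken (grow_processed (cn := cn) (sim_mul sl sa sb)
    (k2 := 1) (k3 := 840 * t ^ 2 + 400 * t)
    (k4 := 210 * t ^ 2 + 1008 * t + 120) _ _ _) (gate_costP _ _ _) _
  => [l' s' sub' bd|l' s' sub' bd|l' s' sub' bd ck| | | |//] //.
- have [/ga[ka _] /gb[kb _] _] := bdd bd.
  rewrite /= natrM.
  exact: knows_mul s' (knows_sub sub' ka) (knows_sub sub' kb).
- have [/ga[_ ra] /gb[_ rb] le_t] := bdd bd.
  apply: (signed_rep_mul s' (has_bits01_sub sub' h01) le_t).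
    exact: signed_rep_sub ra.
  exact: signed_rep_sub rb.
- have [ba bb le_t] := bdd bd; have [ka ra] := ga ba.
  have {}ka := knows_sub sub' ka.
  have kva := knows_sub sub' (sim_knows sa).
  have {}h01 := has_bits01_sub sub' h01.
  (* At a squaring gate conicity says nothing about the input, and the signed representation takes
     over. *)
  have [eab | [cca ccb]] := cab ck.
    rewrite -eab in le_t *.
    by apply: unsigned_rep_sqr => //; apply: signed_rep_sub ra.
  apply: grow_weaken (unsigned_rep_mul s' h01 le_t ka kva _ _) _ _.
  + exact: unsigned_rep_sub (ua ba cca).
  + exact: unsigned_rep_sub (ub bb ccb).
  + by lia.
  + by [].
- by lia.
Qed.

Lemma processed_div l a b (ca cb cn : Prop) : slp l -> has_bits01 l ->
  legal (EDiv a b) -> processed l a ca -> processed l b cb ->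
  (cn -> division_free b -> ca /\ 0 <= ival b) ->
  grow l gate_cost (fun l' => processed l' (EDiv a b) cn).
Proof.
move=> sl h01 lg [sa ga ua] [sb gb ub] cab.
have bdd : bounded (EDiv a b) -> [/\ bounded a, dfd (EDiv a b)
    & division_free b].
  rewrite /bounded /= => /andP[/andP[-> db] ->]; split=> //.
  exact: division_free_esubst db.
apply: grow_weaken (grow_processed (cn := cn) (sim_div rat_pair isT sl lg sa sb)
    (k2 := 3) (k3 := 0) (k4 := 0) _ _ _) (gate_costP _ _ _) _
  => [l' s' sub' bd|l' s' sub' bd|l' s' sub' bd ck| | | |//] //.
- have [/ga[ka _] df _] := bdd bd.
  exact: knows_mult_div s' lg df (knows_sub sub' ka) (knows_sub sub' (sim_knows sb)).
- have [/ga[_ ra] df _] := bdd bd.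
  exact/grow_refl/(signed_rep_div lg df)/(signed_rep_sub sub').
- have [ba df dfb] := bdd bd; have [cca b0] := cab ck dfb.
  exact/grow_refl/(unsigned_rep_div lg df b0)/(unsigned_rep_sub sub')/ua.
Qed.

Lemma processed_node l k : constant_free C -> (k < csize C)%N ->
  slp l -> has_bits01 l ->
  (forall i, (i < k)%N -> processed l (node i) (conic_at i)) ->
  {in placeholders C, forall a : ineq n m, placeholder_ready F l a} ->
  grow l (gate_cost * ~~ is_placeholder (gate_at C k))
    (fun l' => processed l' (node k) (conic_at k)).
Proof.
move=> cfC lt_k sl h01 prev ready.
have [/topologicalP[_ top] sm _] := and3P cfC.
(* The empty path at [k] is used; since a leaf is never a squaring gate, this refutes conicity of
   negative constants and x-variables. *)
have ck_leaf : conic_at k -> must_be_squared (gate_at C k) -> squaring C k.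
  by move=> ck mbs; have := ck k [::] mbs isT erefl; rewrite /= orbF.
have input i := @conic_at_input k i.
have := ival_conic cfC lt_k; have := legal_at cfC lt_k; have := top _ lt_k.
have := (all_nthP (Const 0) sm) _ lt_k; rewrite expr_atE //.
move: ck_leaf input (@mem_placeholders _ _ C k); rewrite /squaring /gate_at.
case: (nth _ _ k) => [[i|a]|c|i j|i j|i j] /= ck_leaf input memp smk topk lgk ivk;
  rewrite ?muln1.
- by apply: processed_var => // ck; have := ck_leaf ck isT.
- rewrite muln0; apply: grow_refl => //.
  by apply: processed_placeholder => //; apply/ready/(memp _ lt_k).
- by apply: processed_const => // c0 ck; have := ck_leaf ck c0.
- case/and3P: topk => /prev hi /prev hj _.
  apply: (processed_add sl h01 lgk hi hj) => ck.
  by split; apply: input; rewrite ?inE ?eqxx ?orbT.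
- case/and3P: topk => /prev hi /prev hj _.
  apply: (processed_mul sl h01 lgk hi hj) => ck.
  have [-> | nij] := eqVneq i j; [by left | right].
  by split; apply: input; rewrite ?inE ?eqxx ?orbT ?(negbTE nij).
- case/and3P: topk => lt_i lt_j _.
  apply: (processed_div sl h01 lgk (prev _ lt_i) (prev _ lt_j)) => ck dfb.
  have [ci cj] : conic_at i /\ conic_at j.
    by split; apply: input; rewrite ?inE ?eqxx ?orbT.
  split=> //; apply: ival_conic => //; first exact: ltn_trans lt_k.
  by case/and4P: lgk.
Qed.

Lemma processed_all l k : constant_free C -> (k <= csize C)%N ->
  slp l -> has_bits01 l ->
  {in placeholders C, forall a : ineq n m, placeholder_ready F l a} ->
  grow l (gate_cost * count (predC (@is_placeholder n m)) (take k (nodes C)))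
    (fun l' => forall i, (i < k)%N -> processed l' (node i) (conic_at i)).
Proof.
move=> cfC le_k sl h01 ready; elim: k le_k => [|k IH] lt_k; first exact: grow_refl.
rewrite (take_nth (Const 0)) // -cats1 count_cat mulnDr.
apply: (grow_bind (IH (ltnW lt_k)) (leqnn _)) => l1 s1 sub1 h1.
have h011 := has_bits01_sub sub1 h01.
have ready1 : {in placeholders C, forall a : ineq n m, placeholder_ready F l1 a}.
  by move=> a /ready; apply: placeholder_ready_sub.
apply: grow_weaken (processed_node cfC lt_k s1 h011 h1 ready1) _ _.
  by rewrite /= addn0.
move=> l2 s2 sub2 h2 i; rewrite ltnS leq_eqVlt => /predU1P[-> // | /h1].
exact: processed_sub.
Qed.

End Simulation.

(** * The size of the multiplier *)

Section Tau.
Variables (n m : nat) (C : circuit (cps_var n m)).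
Hypothesis cfC : constant_free C.
Local Notation rho := (fun v : void => match v with end : rat).
Local Notation slp := (slp false rho).
Local Notation grow := (grow false rho).
Local Notation node k := (expr_at (nodes C) k).

(** Integer values are tracked beside multipliers because a division gate multiplies by |b|. Three
    gates per node suffice: at a division, two for a change of sign and one for the product. *)
Definition mult_known (l : seq (bool * rat)) (e : expr (cps_var n m)) :=
  (variable_free e -> division_free e -> knows l (ival e)%:~R) /\
  (division_free_denominators e -> knows l (mult_nat e)%:R).

Lemma mult_known_sub l l' e : {subset l <= l'} -> mult_known l e -> mult_known l' e.
Proof.
by move=> sub [h1 h2]; split=> [v d|d]; apply: knows_sub sub _; [apply: h1|apply: h2].
Qed.

Lemma mult_known_node l k : (k < csize C)%N -> slp l ->
  (forall c : int, c \in [:: 0; 1; -1] -> knows l c%:~R) ->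
  (forall i, (i < k)%N -> mult_known l (node i)) ->
  grow l (3 * ~~ is_placeholder (gate_at C k)) (fun l' => mult_known l' (node k)).
Proof.
move=> lt_k sl consts prev; have [/topologicalP[_ top] sm _] := and3P cfC.
have k1 : knows l 1%:R by apply: (consts 1).
have := legal_at cfC lt_k; have := top _ lt_k.
have := (all_nthP (Const 0) sm) _ lt_k; rewrite expr_atE // /gate_at.
case: (nth _ _ k) => [[i|a]|c|i j|i j|i j] /= smk topk lgk; rewrite ?muln1.
- by apply: grow_refl.
- by apply: grow_refl.
- by apply: grow_refl => //; split=> // _ _; apply: consts.
- case/and3P: topk => /prev[vi mi] /prev[vj mj] _.
  rewrite -!/(expr_at _ _) in lgk *.
  move: (node i) (node j) => a b in vi mi vj mj lgk *.
  have g : grow l 1 (fun l' => variable_free (EAdd a b) -> division_free (EAdd a b) ->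
      knows l' (ival (EAdd a b))%:~R).
    have [/=|nv] := boolP (variable_free (EAdd a b) && division_free (EAdd a b)).
      case/andP=> /andP[va vb] /andP[da db].
      apply: grow_weaken (knows_add sl (vi va da) (vj vb db)) _ _ => // l' _ _.
      by rewrite intrD.
    by apply: grow_refl => // v d; rewrite v d in nv.
  apply: (grow_bind g (k2 := 1)) => // l1 s1 sub1 h1.
  have [/=|nv] := boolP (division_free_denominators (EAdd a b)).
    case/andP=> da db.
    have g2 := knows_mul s1 (knows_sub sub1 (mi da)) (knows_sub sub1 (mj db)).
    apply: grow_weaken g2 _ _ => // l2 _ sub2 h2.
    split=> [v d|_]; first by apply: knows_sub sub2 _; apply: h1.
    by rewrite natrM.
  by apply: grow_refl => //; split=> // d; rewrite d in nv.
- case/and3P: topk => /prev[vi mi] /prev[vj mj] _.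
  rewrite -!/(expr_at _ _) in lgk *.
  move: (node i) (node j) => a b in vi mi vj mj lgk *.
  have g : grow l 1 (fun l' => variable_free (EMul a b) -> division_free (EMul a b) ->
      knows l' (ival (EMul a b))%:~R).
    have [/=|nv] := boolP (variable_free (EMul a b) && division_free (EMul a b)).
      case/andP=> /andP[va vb] /andP[da db].
      apply: grow_weaken (knows_mul sl (vi va da) (vj vb db)) _ _ => // l' _ _.
      by rewrite intrM.
    by apply: grow_refl => // v d; rewrite v d in nv.
  apply: (grow_bind g (k2 := 1)) => // l1 s1 sub1 h1.
  have [/=|nv] := boolP (division_free_denominators (EMul a b)).
    case/andP=> da db.
    have g2 := knows_mul s1 (knows_sub sub1 (mi da)) (knows_sub sub1 (mj db)).
    apply: grow_weaken g2 _ _ => // l2 _ sub2 h2.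
    split=> [v d|_]; first by apply: knows_sub sub2 _; apply: h1.
    by rewrite natrM.
  by apply: grow_refl => //; split=> // d; rewrite d in nv.
- case/and3P: topk => /prev[_ mi] /prev[vj _] _.
  rewrite -!/(expr_at _ _) in lgk *.
  move: (node i) (node j) => a b in mi vj lgk *.
  have [/=|nv] := boolP (division_free_denominators (EDiv a b)); last first.
    by apply: grow_refl => //; split=> // d; rewrite d in nv.
  case/andP=> da db; have /and4P[_ _ vb _] := lgk.
  have g : grow l 2 (fun l' => knows l' (`|ival b|%N)%:R).
    have [b0 | b0] := leP 0 (ival b).
      by apply: grow_refl => //; rewrite pmulrn (gez0_abs b0); apply: vj.
    apply: grow_weaken (grow_neg sl (vj vb db)) _ _ => // l' _ _.
    by rewrite pmulrn (ltz0_abs b0) rmorphN.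
  apply: (grow_bind g (k2 := 1)) => // l1 s1 sub1 h1.
  apply: grow_weaken (knows_mul s1 (knows_sub sub1 (mi da)) h1) _ _ => // l2 _ _ h2.
  by split=> //= _; rewrite natrM.
Qed.

Lemma mult_known_all l k : (k <= csize C)%N -> slp l ->
  (forall c : int, c \in [:: 0; 1; -1] -> knows l c%:~R) ->
  grow l (3 * count (predC (@is_placeholder n m)) (take k (nodes C)))
    (fun l' => forall i, (i < k)%N -> mult_known l' (node i)).
Proof.
move=> le_k sl consts; elim: k le_k => [|k IH] lt_k; first exact: grow_refl.
rewrite (take_nth (Const 0)) // -cats1 count_cat mulnDr.
apply: (grow_bind (IH (ltnW lt_k)) (leqnn _)) => l1 s1 sub1 h1.
have consts1 (c : int) : c \in [:: 0; 1; -1] -> knows l1 c%:~R.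
  by move/consts; apply: knows_sub.
apply: grow_weaken (mult_known_node lt_k s1 consts1 h1) _ _.
  by rewrite /= addn0.
move=> l2 s2 sub2 h2 i; rewrite ltnS leq_eqVlt => /predU1P[-> // | /h1].
exact: mult_known_sub.
Qed.

(** The successor in the bound pays for the three initial constants 0, 1, -1. *)
Lemma mult_computed : division_free_denominators (unfold C) ->
  exists2 B, computes_int B (mult_nat (unfold C)) &
    (csize B <= 3 * (count (predC (@is_placeholder n m)) (nodes C)).+1)%N.
Proof.
move=> dfd; have [/topologicalP[lt_o _] _ _] := and3P cfC.
have [c0 c1 cN1] : [/\ (0 : int) \in [:: 0; 1; -1], (1 : int) \in [:: 0; 1; -1]
    & (-1 : int) \in [:: 0; 1; -1]] by rewrite !inE !eqxx !orbT.
have s0 := slp_const (slp_const (slp_const (slp_nil false rho) c0) c1) cN1.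
have [|l [sl _ szl known]] := mult_known_all (leqnn (csize C)) s0.
  by move=> c; rewrite !inE => /or3P[] /eqP->.
have [f fl] := knowsP _ _ ((known _ lt_o).2 dfd).
have [B [cfB szB eB dB]] := slp_circuit (idfun : {rmorphism rat -> rat}) sl fl.
exists B; first by split=> //; apply/negP => /dB.
by rewrite szB (leq_trans szl) // take_size mulnS.
Qed.

Lemma tau_exists (M : int) B : computes_int B M ->
  exists2 k, is_tau M k & (k <= csize B)%N.
Proof.
move eqs: (csize B) => s; elim/ltn_ind: s B eqs => s IH B eqs cB.
have [[D cD lt_D] | min] := classic (exists2 D, computes_int D M & (csize D < s)%N).
  by have [k tk le_k] := IH _ lt_D D erefl cD; exists k => //; apply: leq_trans (ltnW lt_D).
exists s => //; split; first by exists B.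
by move=> D cD; rewrite leqNgt; apply/negP => lt_D; apply: min; exists D.
Qed.

End Tau.

(** * Use of the binary value principle *)

Section BinaryValue.
Variables (n t : nat).
Local Notation A := {mpoly rat[n]}.

Lemma eq_eeval V (R : unitRingType) (rho1 rho2 : V -> R) e :
  rho1 =1 rho2 -> eeval rho1 e = eeval rho2 e.
Proof. by move=> eqr; elim: e => //= [a -> b ->|a -> b ->|a -> b ->]. Qed.

Lemma val2_sum (p : seq A) : val2 p = \sum_(i < size p) 2 ^+ i * p`_i.
Proof.
elim: p => [|b p IH] /=; first by rewrite big_ord0.
rewrite big_ord_recl expr0 mul1r IH mulr_sumr; congr (_ + _).
by apply: eq_bigr => i _; rewrite /bump /= exprS mulrA.
Qed.

Definition bvp_pair (p : seq A) (M : int) (v : ips_var t 1) : A * A :=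
  match v with
  | IpsX i => diag p`_i
  | IpsY _ => dev (val2 p + M%:~R)
  | IpsZ i => dev (p`_i * p`_i - p`_i)
  end.

(** In each coordinate, evaluation at [bvp_pair] is the image, under the substitution of the bits
    for the variables, of one of the two evaluations that define an IPS refutation; these give 0 and
    1. *)
Lemma bvp_substitute (p : seq A) M B : size p = t -> constant_free B ->
  ips_refutation (@bvp t M) B -> ceval (bvp_pair p M) B = dev 1.
Proof.
move=> szp cfB [e0 e1].
have lgB : legal (unfold B).
  by apply: legal_at => //; case/and3P: cfB => /topologicalP[].
pose lp := [tuple p`_i | i < t].
pose phi : {rmorphism {mpoly rat[t]} -> A} := comp_mpoly lp.
have phiX i : phi 'X_i = p`_i by rewrite /phi /= comp_mpolyXU -tnth_nth tnth_mktuple.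
apply: pair_ext.
- rewrite -(rmorph0 phi) -e0 /ceval.
  rewrite -(eeval_morph (@mpolyC t rat) phi) // -(eeval_morph (rat_pair n) fst) //.
  by apply: eq_eeval => -[i|i|i] /=; rewrite ?phiX ?rmorph0.
- rewrite -(rmorph1 phi) -e1 /ceval.
  rewrite -(eeval_morph (@mpolyC t rat) phi) // -(eeval_morph (rat_pair n) snd) //.
  apply: eq_eeval => -[i|i|i] /=; rewrite ?phiX //.
    rewrite /bvp rmorphD rmorph_int rmorph_sum val2_sum szp; congr (_ + _).
    by apply: eq_bigr => k _; rewrite rmorphM rmorphXn /= rmorph_nat phiX.
  by rewrite rmorphB rmorphXn /= phiX expr2.
Qed.

End BinaryValue.

(** * Assembly of the IPS refutation *)

Section Refutation.
Variables (n m : nat) (F : 'I_m -> circuit 'I_n) (C : circuit (cps_var n m)).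
Hypotheses (cfF : forall j, constant_free (F j)) (cfC : constant_free C).
Local Notation A := {mpoly rat[n]}.
Local Notation slp := (slp true (ips_pair F)).
Local Notation grow := (grow true (ips_pair F)).

Lemma cps_value : ceval (cps_at_axioms F) C = -1 ->
  (ceval (cps_pair F) C).2 = -1.
Proof.
move=> <-; rewrite /ceval -(eeval_morph (rat_pair n) snd) //=; last first.
  by apply: legal_at => //; case/and3P: cfC => /topologicalP[].
by apply: eq_eeval => v; rewrite cps_pair2.
Qed.

Lemma slp_start : exists l, [/\ slp l, has_bits01 l & size l = 2].
Proof.
have [c0 c1] : (0 : int) \in [:: 0; 1; -1] /\ (1 : int) \in [:: 0; 1; -1].
  by rewrite !inE !eqxx !orbT.
have s0 := slp_const (slp_const (slp_nil true (ips_pair F)) c0) c1.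
eexists; split; [exact: s0 | | by []].
have k0 : knows [:: (true, 0%:~R); (true, 1%:~R)] (0 : A * A).
  by rewrite /knows /= inE eqxx.
have k1 : knows [:: (true, 0%:~R); (true, 1%:~R)] (1 : A * A).
  by rewrite /knows /= !inE eqxx orbT.
split; split; [exact: k0 | | exact: k1 |].
  by rewrite mulr0 subrr; exact: k0.
by rewrite mulr1 subrr; exact: k0.
Qed.

(** The output is conic with value -1 at the axioms, so its unsigned representation derives -M -
    [val2 p]; one negation gives the equation of the binary value principle at the bits of [p]. *)
Lemma bvp_derived t : cps_refutation F C ->
  has_syntactic_length (subst_axioms F C) t ->
  exists l (p : seq A),
    [/\ slp l, size p = t, bits l p,
        knows l (dev (val2 p + (mult_nat (unfold C))%:R))
      & (size l <= 4 + 10 * csize (subst_axioms F C) +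
           gate_cost t * csize (subst_axioms F C))%N].
Proof.
case=> cC eC [dfD lenD].
have [lt_o _] : (output C < csize C)%N /\ topological (nodes C).
  by apply: topologicalP; case/and3P: cfC.
have [eqD szD] := @subst_axiomsP n m F (fun j => proj1 (andP (cfF j))) C
  (proj1 (andP cfC)).
have [l0 [s0 h0 sz0]] := slp_start.
have [l1 [s1 sub1 sz1 ready]] := grow_placeholders (placeholders C) s0.
have h1 := has_bits01_sub sub1 h0.
have [l2 [s2 sub2 sz2 h2]] := processed_all t cfC (leqnn _) s1 h1 ready.
have bd : bounded F t (unfold C) by rewrite /bounded -eqD dfD lenD leqnn.
have [_ _ /(_ bd cC)[p [szp hp kp]]] := h2 _ lt_o.
have le_p : (size p <= t)%N by move: szp; rewrite -lenD eqD.
(* Padding to exactly [t] bits matches the number of variables of the principle. *)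
have [p' [szp' hp' vp']] := bits_pad (has_bits01_sub sub2 h1) hp le_p.
rewrite -vp' in kp.
have [l3 [s3 sub3 sz3 k3]] := grow_neg s2 kp.
exists l3, p'; split=> //; first exact: bits_sub hp'.
  congr (knows _ _): k3; apply: pair_ext; first exact: oppr0.
  rewrite snd_opp /=; have := cps_value eC; rewrite /ceval => ->.
  by rewrite mulrN1 opprB opprK addrC.
apply: leq_trans sz3 _; move: sz2; rewrite take_size => sz2.
have := leq_trans sz2 (leq_add sz1 (leqnn _)); rewrite sz0.
set N := count _ _ in szD *; set P := size _ in szD *; set S := csize _ in szD *.
have le_P : (P <= S)%N by exact: leq_trans (leq_addr _ _) szD.
have le_N : (N <= S)%N by exact: leq_trans (leq_addl _ _) szD.
have := leq_mul (leqnn (gate_cost t)) le_N.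
by move: (gate_cost t * N)%N (gate_cost t * S)%N => x y; lia.
Qed.

Lemma ips_refutation_from_bvp t r B : cps_refutation F C ->
  has_syntactic_length (subst_axioms F C) t ->
  constant_free B -> ips_refutation (bvp t (mult_nat (unfold C))) B ->
  (csize B <= r)%N ->
  exists P : circuit (ips_var n m),
    [/\ constant_free P, ips_refutation (fun j => cpoly (F j)) P
      & (csize P <= 4 + 10 * csize (subst_axioms F C) +
           gate_cost t * csize (subst_axioms F C) + r)%N].
Proof.
move=> ref hlen cfB refB le_r.
have [l [p [sl szp hp kM szl]]] := bvp_derived ref hlen.
have ready (v : ips_var t 1) : knows l (bvp_pair p (mult_nat (unfold C)) v).
  case: v => [i|i|i] /=; [|by rewrite -pmulrn|].
    by have [] := hp p`_i (mem_nth 0 (leq_trans (ltn_ord i) (eq_leq (esym szp)))).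
  by have [] := hp p`_i (mem_nth 0 (leq_trans (ltn_ord i) (eq_leq (esym szp)))).
have [l' [sl' _ szl' /knowsP[f fl]]] := sim_circuit (rat_pair n) isT sl cfB ready.
rewrite (bvp_substitute szp cfB refB) in fl.
have [P [cfP szP eP _]] := slp_circuit (rat_pair n) sl' fl.
have lgP : legal (unfold P).
  by apply: legal_at => //; case/and3P: cfP => /topologicalP[].
exists P; split=> //; last first.
  by rewrite szP (leq_trans szl') // leq_add.
split.
- have /(congr1 fst) /= <- := eP.
  by rewrite /ceval -(eeval_morph (rat_pair n) fst).
- have /(congr1 snd) /= <- := eP.
  by rewrite /ceval -(eeval_morph (rat_pair n) snd).
Qed.

End Refutation.

Theorem theorem6p2 :
  exists (c0 : nat) (q : {mpoly int[3]}),
  forall (n m : nat) (F : 'I_m -> circuit 'I_n) (C : circuit (cps_var n m))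
         (s t r : nat),
    (forall j, constant_free (F j)) ->
    constant_free C ->
    cps_refutation F C ->
    csize (subst_axioms F C) = s ->
    has_syntactic_length (subst_axioms F C) t ->
    (1 <= r)%N ->
    (forall (M : int) (k : nat),
       0 < M -> is_tau M k -> (k <= c0 * s)%N ->
       exists B : circuit (ips_var t 1),
         [/\ constant_free B, ips_refutation (bvp t M) B & (csize B <= r)%N]) ->
    exists P : circuit (ips_var n m),
      [/\ constant_free P,
          ips_refutation (fun j => cpoly (F j)) P
        & (csize P)%:Z <= q.@[tnth [tuple s%:Z; t%:Z; r%:Z]]].
Proof.
pose i0 : 'I_3 := inord 0; pose i1 : 'I_3 := inord 1; pose i2 : 'I_3 := inord 2.
(* The 6 comes from 3 (N + 1) <= 6 s, where N <= s counts the nodes of [C] other than placeholders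
   and s >= 1. In the polynomial, 4 pays for two constants and the final negation, [10] is the cost
   per distinct placeholder, the next term is [gate_cost] per remaining node, and the last is the
   inserted refutation. *)
exists 6%N, (4%:MP + 10%:MP * 'X_i0 + 2000%:MP * ('X_i1 + 1) ^+ 2 * 'X_i0 + 'X_i2).
move=> n m F C s t r cfF cfC ref eqs hlen _ hB.
have [/topologicalP[lt_o top] _ _] := and3P cfC.
have [eqD szD] := @subst_axiomsP n m F (fun j => proj1 (andP (cfF j))) C
  (proj1 (andP cfC)).
have dfC : division_free_denominators (unfold C).
  by apply: (@division_free_denominators_esubst n m F); rewrite -eqD; case: hlen.
have lgC : legal (unfold C) by apply: legal_at.
have s_gt0 : (0 < s)%N.
  rewrite -eqs; apply: leq_trans szD; rewrite addn_gt0 orbC -has_count.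
  have [hp | np] := boolP (is_placeholder (gate_at C (output C))).
    have memp a := @mem_placeholders _ _ C _ a lt_o.
    apply/orP; right; move: hp memp; rewrite /gate_at.
    by case: (nth _ _ _) => // -[//|a] _ /(_ a erefl); case: placeholders.
  by apply/orP; left; apply/(has_nthP (Const 0)); exists (output C).
have [B0 cB0 szB0] := mult_computed cfC dfC.
have [k tk le_k] := tau_exists cB0.
have M_gt0 : (0 : int) < mult_nat (unfold C) by rewrite ltz_nat mult_nat_gt0.
have [|B [cfB refB le_r]] := hB _ k M_gt0 tk.
  by apply: leq_trans le_k (leq_trans szB0 _); rewrite -eqs in s_gt0 *; lia.
have [P [cfP refP szP]] := ips_refutation_from_bvp cfF cfC ref hlen cfB refB le_r.
exists P; split=> //.
rewrite !(mevalD, mevalM, mevalC, mevalXU, rmorphXn, rmorph1) /=.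
rewrite !(tnth_nth 0) /= !inordK //=.
rewrite eqs /gate_cost in szP.
by move: szP; rewrite -mulnn -addn1; lia.
Qed.
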